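(* Let $\gamma\colon [a,b]\to \mathbb{R}^{4}$ be a horizontal curve in the Engel group. Then there exists a $C^{1}$ horizontal curve $\Gamma\colon [a,b]\to \mathbb{R}^{4}$ in the Engel group such that $$m\{t\in [a,b]:\Gamma(t)=\gamma(t)\}>0.$$
   Context: $m$ denotes Lebesgue measure on $\mathbb{R}$, and $a<b$. The Engel group $\mathbb{E}$ is the connected, simply connected Lie group whose Lie algebra is $V_1\oplus V_2\oplus V_3$ with $V_1=\mathrm{span}\{X_1,X_2\}$, $V_2=\mathrm{span}\{X_3\}$, $V_3=\mathrm{span}\{X_4\}$ (of dimension 4) and only non-zero brackets of basis vectors $[X_1,X_2]=X_3$, $[X_1,X_3]=X_4$ (up to antisymmetry). It is identified with $\mathbb{R}^4$ by exponential coordinates of the second kind, $(x_1,x_2,x_3,x_4)\leftrightarrow\exp(x_4X_4)\exp(x_3X_3)\exp(x_2X_2)\exp(x_1X_1)$, in which the horizontal left invariant vector fields are $$X_1(x)=\partial_1,\qquad X_2(x)=\partial_2+x_1\partial_3+\tfrac12x_1^2\partial_4.$$ A curve $\gamma:[a,b]\to\mathbb{R}^4$ is horizontal if it is absolutely continuous and for almost every $t\in[a,b]$ its Euclidean derivative has the form $\dot\gamma(t)=u_1(t)X_1(\gamma(t))+u_2(t)X_2(\gamma(t))$ with $u_1(t),u_2(t)\in\mathbb{R}$. A $C^1$ horizontal curve is a horizontal curve that is continuously differentiable as a map into $\mathbb{R}^4$. *)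

(* Defs.v *)
From mathcomp Require Import all_boot all_order all_algebra.
From mathcomp Require Import all_classical all_reals all_analysis.

Set Implicit Arguments.
Unset Strict Implicit.
Unset Printing Implicit Defensive.

Import Order.TTheory GRing.Theory Num.Theory.
Import numFieldNormedType.Exports.

Local Open Scope classical_set_scope.
Local Open Scope ring_scope.

(* A curve [a, b] -> V is represented by a total function R -> V; each notion
   below depends only on its values on [a, b]. *)

(* For 'rV[R]_n the norm below is the sup norm, which gives the same
   absolutely continuous curves as the Euclidean norm. *)
Definition absolutely_continuous (R : realType) (V : normedModType R)
    (a b : R) (f : R -> V) : Prop :=
  forall e : R, 0 < e -> exists2 d : R, 0 < d &
    forall (n : nat) (x y : 'I_n -> R),
      (forall i, a <= x i /\ x i <= y i /\ y i <= b) ->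
      trivIset [set: 'I_n] (fun i => [set` `]x i, y i[]) ->
      \sum_(i < n) (y i - x i) < d ->
      \sum_(i < n) `|f (y i) - f (x i)| < e.

(* Derivative at t of a curve defined on [a, b] only: one-sided at a and b. *)
Definition has_derivative_on (R : realType) (V : normedModType R)
    (a b : R) (f : R -> V) (t : R) (v : V) : Prop :=
  (s - t)^-1 *: (f s - f t) @[s --> within `[a, b] t^'] --> v.

Definition C1_on (R : realType) (V : normedModType R)
    (a b : R) (f : R -> V) : Prop :=
  exists2 f' : R -> V,
    (forall t, t \in `[a, b] -> has_derivative_on a b f t (f' t)) &
    {within `[a, b], continuous f'}.

(* Horizontal left invariant vector fields of the Engel group in exponential
   coordinates of the second kind; x_1, ..., x_4 are the entries of columns
   0, ..., 3. *)
Definition engel_X1 (R : realType) (x : 'rV[R]_4) : 'rV[R]_4 :=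
  \row_(i < 4) [:: 1; 0; 0; 0]`_i.

Definition engel_X2 (R : realType) (x : 'rV[R]_4) : 'rV[R]_4 :=
  \row_(i < 4) [:: 0; 1; x 0 0; 2^-1 * x 0 0 ^+ 2]`_i.

(* The endpoints are negligible, so the two-sided derivative on ]a, b[ covers
   almost every t in [a, b]. *)
Definition engel_horizontal (R : realType) (a b : R) (g : R -> 'rV[R]_4)
    : Prop :=
  absolutely_continuous a b g /\
  {ae (@lebesgue_measure R), forall t : R, t \in `]a, b[ ->
     exists u1 u2 : R,
       is_derive t 1 g (u1 *: engel_X1 (g t) + u2 *: engel_X2 (g t))}.

Definition engel_C1_horizontal (R : realType) (a b : R) (g : R -> 'rV[R]_4)
    : Prop :=
  engel_horizontal a b g /\ C1_on a b g.

(* Main.v *)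
Require Import Defs.
From mathcomp Require Import all_boot all_order all_algebra.
From mathcomp Require Import all_classical all_reals all_analysis.
From mathcomp Require Import measurable_realfun ring lra.
Import Order.TTheory GRing.Theory Num.Theory.
Import numFieldNormedType.Exports.
Local Open Scope classical_set_scope.
Local Open Scope ring_scope.
Set Implicit Arguments.
Unset Strict Implicit.
Unset Printing Implicit Defensive.

(** In coordinates a curve is horizontal when x3' = x1 x2' and
    x4' = (1/2) x1^2 x2' almost everywhere.  Put

      f2 = x2,   f1 = x1 x2 - x3,   f0 = (1/2) x1^2 x2 - x1 x3 + x4.

    Then df0 = f1 dx1 and df1 = f2 dx1: where x1 can serve as a parameter, the
    curve is the 2-jet of a function of x1 whose third derivative is x2'/x1'
    (the Engel group is the jet space J^2(R, R)).  Conversely, for ANY C^1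
    function X1 and any C^3 function h0 with derivatives h1, h2, h3, the curve

      (X1, h2(X1), X1 h2(X1) - h1(X1), h0(X1) - X1 h1(X1) + (1/2) X1^2 h2(X1))

    is C^1 and horizontal.  So it suffices to extend x1 from a compact set K of
    positive measure to a C^1 function, and the jet (f0, f1, f2, x2'/x1') from
    x1(K) to a C^3 function.  Both are instances of the one-dimensional Whitney
    theorem [whitney_extension], proved here for every order by Hermite
    interpolation across the gaps of the closed set.

    If x1' = 0 almost everywhere there is no such parameter, but then x1 is
    constant and x3, x4 are affine functions of x2, so that a C^1 extension of
    x2 alone does the job ([engel_lusin_constant]).  Otherwise
    [derivative_dichotomy] gives a set of positive measure on which x1 expands
    distances by a factor c > 0, and K is chosen inside it
    ([engel_lusin_transverse]).

    What has to be shown on K is that the Taylor remainders of f2, f1, f0 along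
    x1 are o(d), o(d^2), o(d^3) uniformly.  For f2 this is uniform
    differentiability of x1 and x2, which holds off a set of small measure
    ([uniform_derivative_off_small]).  The remainders of f1 and f0 are obtained
    by integrating against dx1, each integration costing a factor equal to the
    variation of x1 over the interval ([jet_estimate]); differentiability of x1
    at a point does not control that variation, but off a set of small measure
    the variation over [t, s] is at most M (s - t)
    ([right_lipschitz_off_small]).  The integration itself is
    [ac_increment_le], a comparison principle for absolutely continuous
    functions that only sees local increments, so that no integral has to be
    formed. *)

(** * Epsilon-delta forms of derivative, continuity and closedness *)

Section epsilon_delta.
Context {R : realType} {V : normedModType R}.

Lemma is_derive_epsP (f : R -> V) (x : R) (l : V) :
  is_derive x 1 f l <-> forall e : R, 0 < e -> exists2 d, 0 < d &
    forall y, `|y - x| < d -> `|f y - f x - (y - x) *: l| <= e * `|y - x|.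
Proof.
have E (h : R) : h != 0 ->
    `|l - h^-1 *: (f (h *: 1 + x) - f x)| =
    `|f (x + h) - f x - h *: l| / `|h|.
  move=> h0; rewrite -[h *: 1]/(h * 1) mulr1 [h + x]addrC.
  have -> : f (x + h) - f x - h *: l = h *: (h^-1 *: (f (x + h) - f x) - l).
    by rewrite scalerBr scalerA divff// scale1r.
  by rewrite normrZ mulrAC divff ?normr_eq0// mul1r distrC.
split.
  move=> [dv dl] e e0.
  have : h^-1 *: ((f \o shift x) (h *: 1) - f x) @[h --> 0^'] --> l.
    by rewrite -dl; apply: dv.
  move=> /cvgrPdist_le /(_ e e0) [d /= d0 H]; exists d => // y yxd.
  have [->|yx] := eqVneq y x; first by rewrite !subrr scale0r subr0 !normr0 mulr0.
  have yx0 : y - x != 0 by rewrite subr_eq0.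
  have := H (y - x); rewrite /ball_/= distrC subr0 E// => /(_ yxd yx0).
  by rewrite ler_pdivrMr ?normr_gt0// subrKC.
move=> H.
have L : h^-1 *: ((f \o shift x) (h *: 1) - f x) @[h --> 0^'] --> l.
  apply/cvgrPdist_le => e e0; have [d d0 Hd] := H e e0.
  exists d => //= h; rewrite /ball_/= distrC subr0 => hd h0.
  rewrite E// ler_pdivrMr ?normr_gt0//.
  by have := Hd (x + h); rewrite addrAC subrr add0r; apply.
by apply: DeriveDef; [apply/cvg_ex; exists l|exact: cvg_lim].
Qed.

Lemma continuous_at_epsP (f : R -> V) (x : R) : {for x, continuous f} <->
  forall e : R, 0 < e -> exists2 d, 0 < d & forall y, `|y - x| < d -> `|f y - f x| <= e.
Proof.
split.
  move=> /cvgrPdist_le H e /H[d /= d0 K]; exists d => // y yx.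
  by rewrite distrC; apply: K => /=; rewrite distrC.
move=> H; apply/cvgrPdist_le => e /H[d d0 K]; exists d => //= y yx.
by rewrite distrC; apply: K; rewrite distrC.
Qed.

Lemma is_derive_continuous (f : R -> V) (x : R) (l : V) :
  is_derive x 1 f l -> {for x, continuous f}.
Proof. by move=> [dv _]; apply/differentiable_continuous/derivable1_diffP. Qed.

End epsilon_delta.

Lemma closed_epsP {R : realType} (A : set R) :
  (forall x, (forall e, 0 < e -> exists2 y, A y & `|y - x| < e) -> A x) -> closed A.
Proof.
move=> H x Ax; apply: H => e e0.
have /Ax [y [Ay yx]] := nbhsx_ballx x e e0.
by exists y => //; rewrite distrC.
Qed.

(** * Hermite interpolation across a gap *)

Section hermite.
Variable R : realType.
Implicit Types (p q : R) (P Q B : {poly R}) (m k j n : nat).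

Lemma derivn_exp_XsubC c n j :
  (('X - c%:P : {poly R}) ^+ n)^`(j) = ('X - c%:P) ^+ (n - j) *+ n ^_ j.
Proof.
elim: j => [|j IH]; first by rewrite derivn0 subn0 ffactn0.
rewrite derivnS IH derivMn deriv_exp derivXsubC mul1r -mulrnA subnS.
by rewrite ffactnSr mulnC.
Qed.

Lemma derivn_dvd_root c n k P : ('X - c%:P) ^+ n %| P -> (k < n)%N ->
  P^`(k).[c] = 0.
Proof.
move=> + kn; have -> : n = (k + (n - k))%N by rewrite subnKC// ltnW.
have : (0 < n - k)%N by rewrite subn_gt0.
move: (n - k)%N => d; elim: k P {n kn} => [|k IH] P d0.
  move=> dP; apply/rootP; rewrite -dvdp_XsubCl (dvdp_trans _ dP)//.
  by rewrite add0n -(prednK d0) exprS dvdp_mulr.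
move=> /dvdpP [S ->]; rewrite derivSn; apply: IH => //.
rewrite derivM deriv_exp derivXsubC mul1r addSn/= dvdp_add//.
  by rewrite dvdp_mull// exprS dvdp_mull.
by rewrite dvdp_mull// -mulr_natr dvdp_mulr.
Qed.

(** By Bezout there are u, v with u X^(m+1) + v (X - 1)^(m+1) = 1.  The
    polynomial u X^(m+1) (X - 1)^k / k! vanishes to order m at 0 and agrees with
    (X - 1)^k / k! modulo (X - 1)^(m+1), hence has the same m-jet at 1. *)
Lemma hermite_basis m : exists B : nat -> {poly R}, forall k j,
  (k <= m)%N -> (j <= m)%N ->
  (B k)^`(j).[0] = 0 /\ (B k)^`(j).[1] = (j == k)%:R.
Proof.
have : coprimep (('X - 0%:P : {poly R}) ^+ m.+1) (('X - 1%:P) ^+ m.+1).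
  apply/coprimep_expl/coprimep_expr; rewrite coprimep_XsubC.
  by rewrite root_XsubC oner_eq0.
move=> /Bezout_eq1_coprimepP[[u v] /= uv].
exists (fun k => (k`!%:R)^-1 *: (u * ('X - 0%:P) ^+ m.+1 * ('X - 1%:P) ^+ k)).
move=> k j km jm; have k0 : k`!%:R != 0 :> R by rewrite pnatr_eq0 -lt0n fact_gt0.
split.
  apply: (@derivn_dvd_root _ m.+1); last by [].
  by rewrite dvdpZr ?invr_eq0// -mulrA dvdp_mull// dvdp_mulr.
have -> : u * ('X - 0%:P) ^+ m.+1 * ('X - 1%:P) ^+ k =
  ('X - 1%:P) ^+ k - v * ('X - 1%:P) ^+ k * ('X - 1%:P) ^+ m.+1.
  rewrite -[X in _ = X - _]mul1r -uv; ring.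
rewrite derivnZ derivnB hornerZ hornerD hornerN.
rewrite (@derivn_dvd_root 1 m.+1 _ (_ * _ ^+ m.+1))//; last exact: dvdp_mull.
rewrite subr0 derivn_exp_XsubC hornerMn horner_exp hornerXsubC subrr.
have [->|jk] := eqVneq j k.
  by rewrite subnn expr0 ffactnn mulVf.
have [kj|jk'] := ltnP k j; first by rewrite ffact_small ?mulr0n ?mulr0.
by rewrite expr0n subn_eq0 leqNgt ltn_neqAle jk jk'/= mul0rn mulr0.
Qed.

Lemma derivn_comp_affine P c p j :
  (P \Po (c *: ('X - p%:P)))^`(j) = c ^+ j *: (P^`(j) \Po (c *: ('X - p%:P))).
Proof.
elim: j => [|j IH]; first by rewrite !derivn0 expr0 scale1r.
rewrite !derivnS IH derivZ deriv_comp derivZ derivXsubC.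
by rewrite -scalerAr mulr1 scalerA exprSr.
Qed.

Lemma horner_unit_le P (x : R) : 0 <= x <= 1 ->
  `|P.[x]| <= \sum_(i < size P) `|P`_i|.
Proof.
move=> /andP[x0 x1]; rewrite horner_coef; apply: le_trans (ler_norm_sum _ _ _) _.
apply: ler_sum => i _; rewrite normrM ler_piMr// ger0_norm ?exprn_ge0//.
by rewrite exprn_ile1.
Qed.

(** The scaling is what matters in the last bound: if the k-th derivatives of P
    and Q at q differ by eta (q - p)^(m-k), the correction rescaled from [0, 1]
    changes the m-th derivative by at most C eta with C depending on m only.
    When p = q the inverse of q - p is 0 and G p p P Q still has the m-jet of P
    at p, so points of the closed set and gaps can be treated by one formula. *)
Lemma gap_interpolation m :
  exists (C : R) (G : R -> R -> {poly R} -> {poly R} -> {poly R}),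
    0 <= C /\ forall p q P Q,
    [/\ forall k, (k <= m)%N -> (G p q P Q)^`(k).[p] = P^`(k).[p],
        p < q -> forall k, (k <= m)%N -> (G p q P Q)^`(k).[q] = Q^`(k).[q] &
        p < q -> forall eta,
          (forall k, (k <= m)%N -> `|(Q - P)^`(k).[q]| <= eta * (q - p) ^+ (m - k)) ->
          forall s, p <= s <= q ->
          `|(G p q P Q)^`(m).[s] - P^`(m).[s]| <= C * eta].
Proof.
have [B HB] := hermite_basis m.
exists (\sum_(k < m.+1) \sum_(i < size (B k)^`(m)) `|(B k)^`(m)`_i|).
exists (fun p q P Q => P + \sum_(k < m.+1) ((Q - P)^`(k).[q] * (q - p) ^+ k) *:
  (B k \Po ((q - p)^-1 *: ('X - p%:P)))).
split; first by apply: sumr_ge0 => ? _; exact: sumr_ge0.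
move=> p q P Q.
have E j s : (P + \sum_(k < m.+1) ((Q - P)^`(k).[q] * (q - p) ^+ k) *:
  (B k \Po ((q - p)^-1 *: ('X - p%:P))))^`(j).[s] = P^`(j).[s] +
  \sum_(k < m.+1) ((Q - P)^`(k).[q] * (q - p) ^+ k) * ((q - p)^-1 ^+ j *
   (B k)^`(j).[(q - p)^-1 * (s - p)]).
  rewrite derivnD hornerD linear_sum horner_sum; congr (_ + _).
  apply: eq_bigr => k _ /=; rewrite derivnZ derivn_comp_affine !hornerZ horner_comp.
  by rewrite hornerZ hornerXsubC.
split.
- move=> k km; rewrite E subrr mulr0 big1 ?addr0// => i _.
  by have [-> _] := HB i k (ltn_ord i) km; rewrite !mulr0.
- move=> pq k km; have pq0 : q - p != 0 by rewrite subr_eq0 gt_eqF.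
  rewrite E mulVf// (bigD1 (Ordinal (km : (k < m.+1)%N)))//= big1 ?addr0.
    have [_ ->] := HB k k km km; rewrite eqxx mulr1 -mulrA exprVn mulfV ?mulr1.
      by rewrite derivnB hornerD hornerN; ring.
    by rewrite expf_neq0.
  move=> i ik; have [_ ->] := HB i k (ltn_ord i) km.
  case: eqP => [e|_]; last by rewrite !mulr0.
  by move/eqP: ik; case; apply: val_inj.
- move=> pq eta Heta s /andP[ps sq]; rewrite E [P^`(m).[s] + _]addrC addrK.
  have pq0 : 0 < q - p by rewrite subr_gt0.
  rewrite mulr_suml; apply: le_trans (ler_norm_sum _ _ _) _.
  apply: ler_sum => k _; have km : (k <= m)%N by rewrite -ltnS.
  set S := (\sum_(i < _) _).
  have HS : `|(B k)^`(m).[(q - p)^-1 * (s - p)]| <= S.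
    apply: horner_unit_le; rewrite mulr_ge0 ?invr_ge0 ?subr_ge0 ?(ltW pq)//=.
    by rewrite mulrC ler_pdivrMr// mul1r lerD2r.
  rewrite mulrA normrM mulrC ler_pM//.
  rewrite !normrM !normrX normfV !(gtr0_norm pq0) -mulrA.
  have -> : (q - p) ^+ k * (q - p)^-1 ^+ m = ((q - p) ^+ (m - k))^-1.
    rewrite -{2}(subnK km) exprD exprVn mulrCA exprVn mulfV ?mulr1//.
    by rewrite expf_neq0// gt_eqF.
  by rewrite ler_pdivrMr ?exprn_gt0// Heta.
Qed.
End hermite.

(** * Whitney extension on the line *)

(** T x plays the part of the Taylor polynomial at x of the function to be
    found; the condition is Whitney's compatibility of the jets, uniformly
    on E. *)
Definition whitney_field {R : realType} (m : nat) (E : set R) (T : R -> {poly R}) :=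
  forall eta : R, 0 < eta -> exists2 rho, 0 < rho &
    forall x y, E x -> E y -> `|y - x| < rho ->
    forall k, (k <= m)%N -> `|(T y - T x)^`(k).[y]| <= eta * `|y - x| ^+ (m - k).

Lemma closed_nearest_left {R : realType} (E : set R) (s : R) : closed E ->
  (exists2 x, E x & x <= s) ->
  exists p, [/\ E p, p <= s & forall x, E x -> x <= s -> x <= p].
Proof.
move=> cE [x0 Ex0 x0s]; pose A := E `&` [set x | x <= s].
have cA : closed A by apply: closedI => //; exact: closed_le.
have A0 : A !=set0 by exists x0.
have bA : has_ubound A by exists s => x [].
have : A (sup A) by rewrite [A in A _](closure_id _).1//; exact: closure_sup.
move=> [Ep ps]; exists (sup A); split => // x Ex xs.
by apply: ub_le_sup.
Qed.

Lemma closed_nearest_right {R : realType} (E : set R) (s : R) : closed E ->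
  (exists2 x, E x & s <= x) ->
  exists q, [/\ E q, s <= q & forall x, E x -> s <= x -> q <= x].
Proof.
move=> cE [x Ex xs].
have [|_ [[q Eq <-] qs qmax]] := @closed_nearest_left _ _ (- s) (closedN cE).
  by exists (- x); [exists x|rewrite lerN2].
exists q; split => //; first by rewrite -lerN2.
by move=> y Ey sy; rewrite -lerN2; apply: qmax; [exists y|rewrite lerN2].
Qed.

Lemma derivn_size_const {R : realType} (P : {poly R}) m : (size P <= m.+1)%N ->
  forall s t, P^`(m).[s] = P^`(m).[t].
Proof.
move=> sP s t; suff -> : P^`(m) = (P^`(m)`_0)%:P by rewrite !hornerC.
apply/polyP => -[|i]; rewrite coefC//= coef_derivn nth_default ?mul0rn//.
by rewrite (leq_trans sP)// addnS ltnS leq_addr.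
Qed.

Section whitney.
Variables (R : realType) (m : nat) (E : set R) (T : R -> {poly R}).
Hypothesis cE : closed E.
Hypothesis Eleft : forall s, exists2 x, E x & x <= s.
Hypothesis Eright : forall s, exists2 x, E x & s <= x.
Hypothesis sizeT : forall x, (size (T x) <= m.+1)%N.
Hypothesis fT : whitney_field m E T.

(** Every point has a nearest point of E on each side, because E is unbounded
    in both directions.  The extension is the interpolating polynomial of
    [gap_interpolation] for these two points.  On short gaps its m-th derivative
    stays close to that of the Taylor polynomials at the endpoints, which gives
    continuity of the top derivative; the lower ones follow by downward
    induction, the mean value theorem on the gaps handling the increments. *)
Lemma whitney_unbounded : exists H : nat -> R -> R,
  [/\ forall k (s : R), (k < m)%N -> is_derive s 1 (H k) (H k.+1 s),
      continuous (H m) &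
      forall x k, E x -> (k <= m)%N -> H k x = (T x)^`(k).[x]].
Proof.
have /boolp.choice[lo Hlo] s := closed_nearest_left cE (Eleft s).
have /boolp.choice[hi Hhi] s := closed_nearest_right cE (Eright s).
have [C [G [C0 HG]]] := gap_interpolation R m.
pose P s := G (lo s) (hi s) (T (lo s)) (T (hi s)).
pose H k s := (P s)^`(k).[s].
have loE s : E s -> lo s = s.
  by move=> Es; have [_ ls ms] := Hlo s; apply/eqP; rewrite eq_le ls ms.
have hiE s : E s -> hi s = s.
  by move=> Es; have [_ ls ms] := Hhi s; apply/eqP; rewrite eq_le ls ms.
have HE s k : E s -> (k <= m)%N -> H k s = (T s)^`(k).[s].
  move=> Es km; have [+ _ _] := HG (lo s) (hi s) (T (lo s)) (T (hi s)).
  by rewrite /H /P loE// => ->.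
have gap s : ~ E s -> lo s < s /\ s < hi s.
  move=> nEs; have [El ls _] := Hlo s; have [Eh hs _] := Hhi s.
  by split; rewrite lt_neqAle ?ls ?hs ?andbT; apply/eqP => e; apply: nEs; [rewrite -e|rewrite e].
have gap_eq s s' : ~ E s -> lo s < s' < hi s ->
    [/\ ~ E s', lo s' = lo s & hi s' = hi s].
  move=> nEs /andP[s'l s'h].
  have [El ls lm] := Hlo s; have [Eh hs hm] := Hhi s.
  have [El' ls' lm'] := Hlo s'; have [Eh' hs' hm'] := Hhi s'.
  have [ss'|s's] := leP s s'.
    have h' : hi s' = hi s.
      by apply/eqP; rewrite eq_le hm' ?(ltW s'h)//= hm// (le_trans ss').
    have l' : lo s' <= s.
      rewrite leNgt; apply/negP => sl'; have := hm _ El' (ltW sl').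
      by rewrite leNgt (le_lt_trans ls').
    split => //; last by apply/eqP; rewrite eq_le lm//= lm'// ltW.
    by move=> Es'; move: l'; rewrite loE// => s's; apply: nEs;
      have -> : s = s' by apply/eqP; rewrite eq_le ss'.
  have l' : lo s' = lo s.
    by apply/eqP; rewrite eq_le lm' ?(ltW s'l)//= lm// (le_trans ls')// ltW.
  have h' : s <= hi s'.
    rewrite leNgt; apply/negP => sl'; have := lm _ Eh' (ltW sl').
    by rewrite leNgt (lt_le_trans s'l).
  split => //; last by apply/eqP; rewrite eq_le hm//= hm'// ltW.
  by move=> Es'; move: h'; rewrite hiE// leNgt s's.
have Hgap s s' k : ~ E s -> lo s <= s' <= hi s -> (k <= m)%N ->
    H k s' = (P s)^`(k).[s'].
  move=> nEs /andP[]; have [lts hts] := gap _ nEs.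
  have [El _ _] := Hlo s; have [Eh _ _] := Hhi s.
  have [g1 g2 _] := HG (lo s) (hi s) (T (lo s)) (T (hi s)).
  rewrite le_eqVlt => /predU1P[<- _ km|ls']; first by rewrite HE// /P g1.
  rewrite le_eqVlt => /predU1P[-> km|hs' km].
    by rewrite HE// /P g2// (lt_trans lts).
  have [|_ l' h'] := @gap_eq s s' nEs; first by rewrite ls'.
  by rewrite /H /P l' h'.
have short (eta x : R) : 0 < eta -> E x -> exists2 rho, 0 < rho &
    forall s, `|lo s - x| < rho -> hi s - lo s < rho -> `|H m s - H m x| <= eta.
  move=> eta0 Ex.
  have C1 : 0 < C + 1 by rewrite ltr_wpDl.
  have [rho rho0 Hrho] := fT (divr_gt0 eta0 C1).
  exists rho => // s lx hl; have [El ls _] := Hlo s; have [Eh hs _] := Hhi s.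
  have := Hrho _ _ Ex El lx m (leqnn m).
  rewrite subnn expr0 mulr1 derivnB hornerD hornerN => B1.
  have B2 : `|H m s - (T (lo s))^`(m).[s]| <= C * (eta / (C + 1)).
    have [Es|nEs] := pselect (E s).
      by rewrite HE// loE// subrr normr0 mulr_ge0// divr_ge0// ltW.
    have [_ _ g3] := HG (lo s) (hi s) (T (lo s)) (T (hi s)).
    have [lts hts] := gap _ nEs; have lh := lt_trans lts hts.
    apply: g3; rewrite ?ls ?hs// => k km.
    have := Hrho _ _ El Eh; rewrite gtr0_norm ?subr_gt0// => /(_ hl k km).
    exact.
  rewrite (HE x)//.
  rewrite (derivn_size_const (sizeT _) s (lo s)) in B2.
  rewrite (derivn_size_const (sizeT _) x (lo s)).
  set t := (T x)^`(m).[_] in B1 *; set u := (T (lo s))^`(m).[_] in B1 B2.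
  have -> : H m s - t = (H m s - u) + (u - t) by ring.
  apply: le_trans (ler_normD _ _) _; apply: le_trans (lerD B2 B1) _.
  by rewrite -[X in _ + X]mul1r -mulrDl mulrCA mulfV ?mulr1// gt_eqF.
have contE x : E x -> {for x, continuous (H m)}.
  move=> Ex; apply/continuous_at_epsP => e e0.
  have [rho rho0 Hrho] := short e x e0 Ex.
  have Hpoly s : exists2 d, 0 < d & forall y, `|y - x| < d ->
      `|(P s)^`(m).[y] - (P s)^`(m).[x]| <= e.
    exact: (continuous_at_epsP _ _).1 (@continuous_horner _ _ _) e e0.
  have [dr dr0 Hr] : exists2 d, 0 < d & forall y, x <= y < x + d ->
      `|H m y - H m x| <= e.
    (* Either E accumulates close enough to x for all nearby gaps to be short, or
       x is the endpoint of a gap on which H m is a polynomial. *)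
    have [[y [Ey xy yr]]|nE] :=
      pselect (exists y, [/\ E y, x < y & y < x + rho]).
      exists (y - x); first by rewrite subr_gt0.
      move=> s /andP[xs]; rewrite subrKC => sy.
      have [_ ls /(_ _ Ex xs) lx] := Hlo s.
      have [_ hs /(_ _ Ey (ltW sy)) hy] := Hhi s.
      by apply: Hrho; rewrite ?ger0_norm; lra.
    pose s0 := x + rho / 2; have xs0 : x < s0 by rewrite ltrDl divr_gt0.
    have [El0 ls0 /(_ _ Ex (ltW xs0)) lx0] := Hlo s0.
    have lo0 : lo s0 = x.
      apply/eqP; rewrite eq_le lx0 andbT leNgt; apply/negP => xl0.
      by apply: nE; exists (lo s0); split => //; rewrite /s0 in ls0 *; lra.
    have nEs0 : ~ E s0 by move=> Es0; apply: nE; exists s0; split => //; rewrite /s0; lra.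
    have [_ hs0] := gap _ nEs0; have [d d0 Hd] := Hpoly s0.
    exists (Num.min d (s0 - x)); first by rewrite lt_min d0 subr_gt0.
    move=> s /andP[xs]; rewrite -ltrBlDl lt_min => /andP[sd ss0].
    rewrite !(Hgap s0)// ?lo0 ?xs ?lexx/=; last 2 first.
    - by lra.
    - by lra.
    by apply: Hd; rewrite ger0_norm; lra.
  have [dl dl0 Hl] : exists2 d, 0 < d & forall y, x - d < y <= x ->
      `|H m y - H m x| <= e.
    have [[y [Ey xy yr]]|nE] := pselect (exists y, [/\ E y, y < x & x - rho < y]).
      exists (x - y); first by rewrite subr_gt0.
      move=> s /andP[ys sx].
      have [_ ls lm] := Hlo s; have := lm _ Ey; have [_ hs /(_ _ Ex sx) hx] := Hhi s.
      move=> /(_ ltac:(lra)) ly.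
      by apply: Hrho; rewrite ?ler0_norm; lra.
    pose s0 := x - rho / 2; have xs0 : s0 < x by rewrite ltrBlDr ltrDl divr_gt0.
    have [El0 ls0 /(_ _ Ex (ltW xs0)) lx0] := Hhi s0.
    have lo0 : hi s0 = x.
      apply/eqP; rewrite eq_le lx0 /= leNgt; apply/negP => xl0.
      by apply: nE; exists (hi s0); split => //; rewrite /s0 in ls0 *; lra.
    have nEs0 : ~ E s0 by move=> Es0; apply: nE; exists s0; split => //; rewrite /s0; lra.
    have [hs0 _] := gap _ nEs0; have [d d0 Hd] := Hpoly s0.
    exists (Num.min d (x - s0)); first by rewrite lt_min d0 subr_gt0.
    move=> s /andP[]; rewrite ltrBlDr -ltrBlDl lt_min => /andP[sd ss0] xs.
    rewrite !(Hgap s0)// ?lo0 ?xs ?lexx ?andbT/=; last 2 first.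
    - by lra.
    - by lra.
    by apply: Hd; rewrite ler0_norm; lra.
  exists (Num.min dl dr); first by rewrite lt_min dl0.
  move=> y; rewrite lt_min => /andP[yl yr].
  have [xy|yx] := leP x y.
    by apply: Hr; rewrite xy /=; rewrite ger0_norm in yr; lra.
  by apply: Hl; rewrite ltW// andbT; rewrite ler0_norm in yl; lra.
have near_gap s : ~ E s -> exists2 d, 0 < d & forall y k, `|y - s| < d ->
    (k <= m)%N -> H k y = (P s)^`(k).[y].
  move=> nEs; have [ls hs] := gap _ nEs.
  exists (Num.min (s - lo s) (hi s - s)); first by rewrite lt_min !subr_gt0 ls.
  move=> y k; rewrite lt_min !ltr_norml => /andP[/andP[a1 a2] /andP[a3 a4]] km.
  by apply: Hgap => //; lra.
have contN s k : ~ E s -> (k <= m)%N -> {for s, continuous (H k)}.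
  move=> nEs km; have [d d0 Hd] := near_gap s nEs.
  apply/continuous_at_epsP => e e0.
  have [d' d'0 Hd'] := (continuous_at_epsP _ _).1 (@continuous_horner _ (P s)^`(k) s) e e0.
  exists (Num.min d d'); first by rewrite lt_min d0.
  move=> y; rewrite lt_min => /andP[yd yd'].
  by rewrite !Hd ?subrr ?normr0//; exact: Hd'.
have derN s k : ~ E s -> (k < m)%N -> is_derive s 1 (H k) (H k.+1 s).
  move=> nEs km; have [d d0 Hd] := near_gap s nEs.
  have := is_derive_poly (P s)^`(k) s; rewrite -derivnS -Hd// ?subrr ?normr0//.
  move=> /is_derive_epsP Hp; apply/is_derive_epsP => e /Hp [d' d'0 Hd'].
  exists (Num.min d d'); first by rewrite lt_min d0.
  move=> y; rewrite lt_min => /andP[yd yd'].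
  by rewrite !(Hd _ k) ?subrr ?normr0// ?(ltnW km)//; exact: Hd'.
have mvt s u v k : ~ E s -> lo s <= u -> u <= v -> v <= hi s -> (k < m)%N ->
    exists2 c, u <= c <= v & H k v - H k u = H k.+1 c * (v - u).
  move=> nEs lu uv vh km.
  have [|c] := @MVT_segment R (horner (P s)^`(k)) (horner (P s)^`(k.+1)) u v uv.
    by apply: continuous_subspaceT => x; exact: continuous_horner.
  rewrite in_itv/= => /andP[uc cv] e; exists c; first by rewrite uc.
  by rewrite !(Hgap s) ?(ltnW km)//; lra.
(* p is the point of E next to y on the side of x, so the increment from x to y
   splits into one along E and one inside a gap. *)
have reach x y k : E x -> (k < m)%N -> exists p c,
    [/\ E p, `|c - x| <= `|y - x|, `|y - p| + `|p - x| = `|y - x| &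
        H k y - H k p = H k.+1 c * (y - p)].
  move=> Ex km; have [Ey|nEy] := pselect (E y).
    by exists y, x; split; rewrite ?subrr ?normr0 ?add0r// mulr0.
  have [ly hy] := gap _ nEy.
  have [El _ lm] := Hlo y; have [Eh _ hm] := Hhi y.
  have [xy|yx] := leP x y.
    have xl := lm _ Ex xy.
    have [c cb e] := mvt y (lo y) y k nEy (lexx _) (ltW ly) (ltW hy) km.
    exists (lo y), c; split => //.
      by rewrite !ger0_norm; lra.
    by rewrite !ger0_norm; lra.
  have xh := hm _ Ex (ltW yx).
  have [c cb e] := mvt y y (hi y) k nEy (ltW ly) (ltW hy) (lexx _) km.
  exists (hi y), c; split => //.
  - by rewrite !ler0_norm; lra.
  - by rewrite !ler0_norm; lra.
  - by rewrite -opprB e -mulrN opprB.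
have derE x k : E x -> (k < m)%N -> {for x, continuous (H k.+1)} ->
    is_derive x 1 (H k) (H k.+1 x).
  move=> Ex km /continuous_at_epsP cH; apply/is_derive_epsP => e e0.
  have e3 : 0 < e / 3 by rewrite divr_gt0.
  have [d1 d10 Hd1] := cH _ e3; have [d2 d20 Hd2] := fT e3.
  have [d3 d30 Hd3] := (is_derive_epsP _ _ _).1 (is_derive_poly (T x)^`(k) x) _ e3.
  exists (Num.min (Num.min d1 1) (Num.min d2 d3)); first by rewrite !lt_min d10 d20 d30 ltr01.
  move=> y; rewrite !lt_min => /andP[/andP[y1 y1'] /andP[y2 y3]].
  have [p [c [Ep cx ypx Hyp]]] := reach x y k Ex km.
  have px : `|p - x| <= `|y - x| by rewrite -ypx lerDr.
  have B1 : `|H k y - H k p - (y - p) * H k.+1 x| <= e / 3 * `|y - p|.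
    rewrite Hyp mulrC -mulrBr normrM mulrC ler_wpM2r//.
    by apply: Hd1; exact: le_lt_trans y1.
  have B2 : `|(T p - T x)^`(k).[p]| <= e / 3 * `|p - x|.
    apply: le_trans (Hd2 _ _ Ex Ep (le_lt_trans px y2) k (ltnW km)) _.
    rewrite ler_wpM2l// ?(ltW e3)//.
    rewrite -[leRHS]expr1 ler_wiXn2l// ?subn_gt0//.
    by rewrite (le_trans px)// ltW.
  have := Hd3 p (le_lt_trans px y3); rewrite -derivnS => B3.
  have hx := HE x k Ex (ltnW km); have hx1 := HE x k.+1 Ex km.
  have hp := HE p k Ep (ltnW km); rewrite hx hx1; rewrite hp hx1 in B1.
  move: B2; rewrite derivnB hornerD hornerN => B2.
  rewrite -ypx mulrDr; move: B1 B2 B3; rewrite /GRing.scale/=.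
  set a1 := (T p)^`(k).[p]; set a2 := (T x)^`(k).[p]; set a3 := (T x)^`(k).[x].
  set f' := (T x)^`(k.+1).[x] => B1 B2 B3.
  have -> : H k y - a3 - (y - x) * f' =
     (H k y - a1 - (y - p) * f') + ((a1 - a2) + (a2 - a3 - (p - x) * f')) by ring.
  apply: le_trans (ler_normD _ _) _; apply: le_trans (lerD B1 (ler_normD _ _)) _.
  apply: le_trans (lerD (lexx _) (lerD B2 B3)) _.
  have := mulr_ge0 (ltW e0) (normr_ge0 (y - p)).
  have := mulr_ge0 (ltW e0) (normr_ge0 (p - x)); lra.
have cont j : forall s, {for s, continuous (H (m - j)%N)}.
  elim: j => [|j IH] s; first by rewrite subn0; have [/contE//|nE] := pselect (E s); exact: contN.
  have [Es|nEs] := pselect (E s); last by apply: contN => //; exact: leq_subr.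
  have [jm|mj] := ltnP j m; last first.
    have -> : (m - j.+1 = m - j)%N.
      by rewrite subnS; move: mj; rewrite -subn_eq0 => /eqP ->.
    exact: IH.
  have e : (m - j)%N = (m - j.+1).+1 by rewrite subnSK.
  apply: (@is_derive_continuous _ _ _ _ (H (m - j.+1).+1 s)).
  apply: derE => //; first by rewrite -e leq_subr.
  by rewrite -e; exact: IH.
exists H; split => //.
- move=> k s km; have [Es|nEs] := pselect (E s); last exact: derN.
  apply: derE => //; have -> : k.+1 = (m - (m - k.+1))%N by rewrite subKn.
  exact: cont.
- by move=> s; have := cont 0%N s; rewrite subn0.
Qed.
End whitney.

(** A bounded set is made unbounded on both sides by adding two far half-lines
    that carry the zero jet; being at distance at least 1 from E they add no new
    pair of close points. *)
Lemma whitney_extension {R : realType} (m : nat) (E : set R) (T : R -> {poly R}) :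
  closed E -> (exists M, forall x, E x -> `|x| <= M) ->
  (forall x, E x -> (size (T x) <= m.+1)%N) -> whitney_field m E T ->
  exists H : nat -> R -> R,
  [/\ forall k (s : R), (k < m)%N -> is_derive s 1 (H k) (H k.+1 s),
      continuous (H m) &
      forall x k, E x -> (k <= m)%N -> H k x = (T x)^`(k).[x]].
Proof.
move=> cE [M EM] sT fT.
pose T' x := if pselect (E x) then T x else 0.
have T'E x : E x -> T' x = T x by move=> Ex; rewrite /T'; case: pselect.
have T'0 x : ~ E x -> T' x = 0 by move=> nEx; rewrite /T'; case: pselect.
pose E' := E `|` ([set x | x <= - (M + 1)] `|` [set x | M + 1 <= x]).
have cE' : closed E'.
  by apply: closedU => //; apply: closedU; [exact: closed_le|exact: closed_ge].
have [||x||H [H1 H2 H3]] := @whitney_unbounded R m E' T' cE'.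
- move=> s; exists (Num.min s (- (M + 1))); rewrite ?ge_min ?lexx//.
  by right; left; rewrite /= ge_min lexx orbT.
- move=> s; exists (Num.max s (M + 1)); rewrite ?le_max ?lexx//.
  by right; right; rewrite /= le_max lexx orbT.
- have [Ex|nEx] := pselect (E x); first by rewrite T'E// sT.
  by rewrite T'0// size_poly0.
- move=> eta eta0; have [rho rho0 Hrho] := fT _ eta0.
  exists (Num.min rho 1); first by rewrite lt_min rho0 ltr01.
  move=> x y E'x E'y; rewrite lt_min => /andP[yx yx1] k km.
  have far u v : E u -> E' v -> ~ E v -> 1 <= `|v - u|.
    move=> /EM; rewrite ler_norml => /andP[u1 u2] [//|[/= v1|/= v1]] _.
      by rewrite ler0_norm; lra.
    by rewrite ger0_norm; lra.
  have [Ex|nEx] := pselect (E x); have [Ey|nEy] := pselect (E y).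
  + by rewrite !T'E//; exact: Hrho.
  + by have := far _ _ Ex E'y nEy; rewrite leNgt yx1.
  + by have := far _ _ Ey E'x nEx; rewrite distrC leNgt yx1.
  + by rewrite !T'0// subr0 linear0 horner0 normr0 mulr_ge0 ?(ltW eta0)// exprn_ge0.
exists H; split => // x k Ex km; rewrite H3 ?T'E//; by left.
Qed.

(** Adding the expansions of f at x and at y shows that f' is continuous on E,
    which is the Whitney condition of order 1. *)
Lemma C1_extension {R : realType} (E : set R) (f f' : R -> R) :
  closed E -> (exists M, forall x, E x -> `|x| <= M) ->
  (forall e : R, 0 < e -> exists2 d, 0 < d & forall x y, E x -> E y -> `|y - x| < d ->
     `|f y - f x - f' x * (y - x)| <= e * `|y - x|) ->
  exists g g' : R -> R,
    [/\ forall s : R, is_derive s 1 g (g' s), continuous g' &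
        forall x, E x -> g x = f x].
Proof.
move=> cE bE H; pose T x : {poly R} := (f x)%:P + f' x *: ('X - x%:P).
have T0 x y : (T x)^`(0).[y] = f x + f' x * (y - x).
  by rewrite derivn0 /T !hornerE.
have T1 x y : (T x)^`(1).[y] = f' x.
  by rewrite derivn1 /T derivD derivC derivZ derivXsubC !hornerE.
have f'c e : 0 < e -> exists2 d, 0 < d & forall x y, E x -> E y -> `|y - x| < d ->
    `|f' y - f' x| <= e.
  move=> e0; have [|d d0 Hd] := H (e / 2); first by rewrite divr_gt0.
  exists d => // x y Ex Ey yx.
  have [->|xy] := eqVneq y x; first by rewrite subrr normr0 ltW.
  have yx0 : 0 < `|y - x| by rewrite normr_gt0 subr_eq0.
  rewrite -(ler_pM2r yx0) -normrM.
  have := lerD (Hd x y Ex Ey yx) (Hd y x Ey Ex _).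
  rewrite (distrC x y) => /(_ yx) B.
  apply: le_trans (le_trans _ B) _; last by lra.
  apply: le_trans _ (ler_normD _ _).
  by rewrite le_eqVlt; apply/orP; left; apply/eqP; congr `|_|; ring.
have [||Hk [H1 H2 H3]] := @whitney_extension R 1 E T cE bE.
- move=> x _; rewrite (leq_trans (size_polyD _ _))// geq_max.
  rewrite (leq_trans (size_polyC_leq1 _))//=.
  by rewrite (leq_trans (size_scale_leq _ _))// size_XsubC.
- move=> e e0; have [d d0 Hd] := H e e0; have [d' d'0 Hd'] := f'c e e0.
  exists (Num.min d d'); first by rewrite lt_min d0.
  move=> x y Ex Ey; rewrite lt_min => /andP[yd yd'] [|[|//]] _.
    rewrite derivnB hornerD hornerN !T0 subrr mulr0 addr0 expr1.
    by rewrite opprD addrA; exact: Hd.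
  by rewrite derivnB hornerD hornerN !T1 subnn expr0 mulr1; exact: Hd'.
exists (Hk 0%N), (Hk 1%N); split => //.
- by move=> s; exact: H1.
- by move=> x Ex; rewrite H3// T0 subrr mulr0 addr0.
Qed.

(** As for C^1, the Whitney condition on the top coefficient f3 comes from adding
    the expansions of f2 at x and at y. *)
Lemma C3_extension {R : realType} (E : set R) (f0 f1 f2 f3 : R -> R) :
  closed E -> (exists M, forall x, E x -> `|x| <= M) ->
  (forall e : R, 0 < e -> exists2 d, 0 < d & forall x y, E x -> E y -> `|y - x| < d ->
    [/\ `|f0 y - f0 x - f1 x * (y - x) - f2 x * (y - x) ^+ 2 / 2 -
          f3 x * (y - x) ^+ 3 / 6| <= e * `|y - x| ^+ 3,
        `|f1 y - f1 x - f2 x * (y - x) - f3 x * (y - x) ^+ 2 / 2| <= e * `|y - x| ^+ 2 &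
        `|f2 y - f2 x - f3 x * (y - x)| <= e * `|y - x|]) ->
  exists h0 h1 h2 h3 : R -> R,
    [/\ [/\ forall s : R, is_derive s 1 h0 (h1 s),
            forall s : R, is_derive s 1 h1 (h2 s),
            forall s : R, is_derive s 1 h2 (h3 s) & continuous h3] &
        forall x, E x -> [/\ h0 x = f0 x, h1 x = f1 x & h2 x = f2 x]].
Proof.
move=> cE bE H; pose T x : {poly R} := (f0 x)%:P + f1 x *: ('X - x%:P) +
  (f2 x / 2) *: ('X - x%:P) ^+ 2 + (f3 x / 6) *: ('X - x%:P) ^+ 3.
have dX (x : R) n : (('X - x%:P : {poly R}) ^+ n.+1)^`() = n.+1%:R *: ('X - x%:P) ^+ n.
  by rewrite deriv_exp derivXsubC mul1r scaler_nat.
have D1 x : (T x)^`() = (f1 x)%:P + f2 x *: ('X - x%:P) +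
    (f3 x / 2) *: ('X - x%:P) ^+ 2.
  rewrite /T !derivD derivC !derivZ !dX derivXsubC add0r alg_polyC expr1 !scalerA.
  by congr (_ + _ *: _ + _ *: _); field.
have D2 x : (T x)^`(2) = (f2 x)%:P + f3 x *: ('X - x%:P).
  rewrite derivnS derivn1 D1 !derivD derivC !derivZ dX derivXsubC add0r alg_polyC expr1.
  by rewrite scalerA; congr (_ + _ *: _); field.
have T0 x y : (T x)^`(0).[y] = f0 x + f1 x * (y - x) + f2 x / 2 * (y - x) ^+ 2 +
    f3 x / 6 * (y - x) ^+ 3.
  by rewrite derivn0 /T !hornerE.
have T1 x y : (T x)^`(1).[y] = f1 x + f2 x * (y - x) + f3 x / 2 * (y - x) ^+ 2.
  by rewrite derivn1 D1 !hornerE.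
have T2 x y : (T x)^`(2).[y] = f2 x + f3 x * (y - x).
  by rewrite D2 !hornerE.
have T3 x y : (T x)^`(3).[y] = f3 x.
  by rewrite derivnS D2 derivD derivC derivZ derivXsubC !hornerE.
have f3c e : 0 < e -> exists2 d, 0 < d & forall x y, E x -> E y -> `|y - x| < d ->
    `|f3 y - f3 x| <= e.
  move=> e0; have [|d d0 Hd] := H (e / 2); first by rewrite divr_gt0.
  exists d => // x y Ex Ey yx.
  have [->|xy] := eqVneq y x; first by rewrite subrr normr0 ltW.
  have yx0 : 0 < `|y - x| by rewrite normr_gt0 subr_eq0.
  rewrite -(ler_pM2r yx0) -normrM.
  have [_ _ Bx] := Hd x y Ex Ey yx.
  have [|_ _ By] := Hd y x Ey Ex; first by rewrite distrC.
  have := lerD Bx By; rewrite (distrC x y) => B.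
  apply: le_trans (le_trans _ B) _; last by lra.
  apply: le_trans _ (ler_normD _ _).
  by rewrite le_eqVlt; apply/orP; left; apply/eqP; congr `|_|; ring.
have [||Hk [H1 H2 H3]] := @whitney_extension R 3 E T cE bE.
- move=> x _; rewrite /T.
  have XS n : (n <= 3)%N -> (size (('X - x%:P : {poly R}) ^+ n) <= 4)%N.
    by rewrite size_exp_XsubC.
  do !(rewrite (leq_trans (size_polyD _ _))// geq_max; apply/andP; split);
    rewrite ?(leq_trans (size_scale_leq _ _))// ?XS//.
    by rewrite (leq_trans (size_polyC_leq1 _)).
  by rewrite size_XsubC.
- move=> e e0; have [d d0 Hd] := H e e0; have [d' d'0 Hd'] := f3c e e0.
  exists (Num.min d d'); first by rewrite lt_min d0.
  move=> x y Ex Ey; rewrite lt_min => /andP[yd yd'] k.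
  have [B0 B1 B2] := Hd x y Ex Ey yd; have B3 := Hd' x y Ex Ey yd'.
  case: k => [|[|[|[|//]]]] _; rewrite derivnB hornerD hornerN ?T0 ?T1 ?T2 ?T3 /=.
  + by move: B0; congr (`|_| <= _); field.
  + by move: B1; congr (`|_| <= _); field.
  + by move: B2; congr (`|_| <= _); field.
  + by rewrite expr0 mulr1.
exists (Hk 0%N), (Hk 1%N), (Hk 2%N), (Hk 3%N); split => //.
- by split => // s; exact: H1.
- by move=> x Ex; rewrite !H3// T0 T1 T2; split; ring.
Qed.

(** * Real induction and absolutely continuous functions *)

Lemma real_induction {R : realType} (c d : R) (P : R -> Prop) : c <= d -> P c ->
  (forall t, c <= t < d -> P t -> exists2 t', t < t' <= d & P t') ->
  (forall t, c < t <= d ->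
     (forall e, 0 < e -> exists2 s, c <= s & t - e < s <= t /\ P s) -> P t) ->
  P d.
Proof.
move=> cd Pc Pstep Plim; pose S := [set t | c <= t <= d /\ P t].
have Sc : S c by split => //; rewrite lexx.
have hS : has_sup S by split; [exists c|exists d => t [/andP[]]].
have cS : c <= sup S by apply: ub_le_sup Sc; exact: hS.2.
have Sd : sup S <= d by apply: ge_sup; [exists c|move=> t [/andP[]]].
have PS : P (sup S).
  move: cS; rewrite le_eqVlt => /predU1P[<-//|cS]; apply: Plim; first by rewrite cS.
  move=> e e0; have [s [/andP[cs sd] Ps] es] := sup_adherent e0 hS.
  exists s => //; split => //; rewrite es /=; apply: ub_le_sup; first exact: hS.2.
  by split => //; rewrite cs.
move: Sd; rewrite le_eqVlt => /predU1P[<-//|Sd].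
have [|t' /andP[St' t'd] Pt'] := Pstep _ _ PS; first by rewrite cS.
suff : t' <= sup S by rewrite leNgt St'.
apply: ub_le_sup; first exact: hS.2.
by split => //; rewrite t'd (le_trans cS)// ltW.
Qed.

(** Cousin's lemma on fine tagged partitions, in the form of an induction: a
    relation on endpoints that is additive and holds on all small intervals
    around each point holds on [c, d]. *)
Lemma cousin_induction {R : realType} (c d : R) (Q : R -> R -> Prop) : c <= d ->
  (forall x y z, c <= x -> x <= y -> y <= z -> z <= d -> Q x y -> Q y z -> Q x z) ->
  (forall t, c <= t <= d -> exists2 r, 0 < r &
     forall x y, c <= x -> x <= t -> t <= y -> y <= d -> t - r < x -> y < t + r -> Q x y) ->
  Q c d.
Proof.
move=> cd Qtr Qloc; apply: (@real_induction _ c d (Q c)) => //.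
- have [|r r0 Hr] := Qloc c; first by rewrite lexx.
  by apply: Hr => //; rewrite ?ltrBlDr ltrDl.
- move=> t /andP[ct td] Qct; have [|r r0 Hr] := Qloc t; first by rewrite ct ltW.
  exists (Num.min d (t + r / 2)).
    by rewrite lt_min td ltrDl divr_gt0// ge_min lexx.
  have tm : t <= Num.min d (t + r / 2) by rewrite le_min ltW// lerDl divr_ge0// ltW.
  apply: Qtr Qct _ => //; first by rewrite ge_min lexx.
  apply: Hr => //; first by rewrite ge_min lexx.
    by rewrite ltrBlDr ltrDl.
  by rewrite gt_min; apply/orP; right; lra.
- move=> t /andP[ct td] H; have [|r r0 Hr] := Qloc t; first by rewrite td ltW.
  have [s cs [/andP[ts st] Qcs]] := H r r0.
  by apply: Qtr Qcs _ => //; apply: Hr => //; rewrite ltrDl.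
Qed.

Section absolute_continuity.
Variable R : realType.
Implicit Types (a b : R).
Local Notation mu := (@lebesgue_measure R).

Lemma ac_seq (V : normedModType R) a b (f : R -> V) : absolutely_continuous a b f ->
  forall e, 0 < e -> exists2 d, 0 < d & forall s : seq (R * R),
    (forall p, p \in s -> [/\ a <= p.1, p.1 <= p.2 & p.2 <= b]) ->
    pairwise (fun p q => p.2 <= q.1) s ->
    \sum_(p <- s) (p.2 - p.1) < d -> \sum_(p <- s) `|f p.2 - f p.1| < e.
Proof.
move=> acf e e0; have [d d0 Hd] := acf e e0; exists d => // s sab sp.
rewrite !(big_nth (0, 0)) !big_mkord => sd.
apply: (Hd (size s) (fun i => (nth (0, 0) s i).1) (fun i => (nth (0, 0) s i).2)) => //.
- by move=> i; have [] := sab _ (mem_nth (0, 0) (ltn_ord i)).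
- have dis (i j : 'I_(size s)) : (i < j)%N ->
      (nth (0, 0) s i).2 <= (nth (0, 0) s j).1.
    by move=> ij; apply: (pairwiseP (0, 0) sp) => //; exact: ltn_ord.
  move=> i j _ _ [t [/=]]; rewrite !in_itv/= => /andP[i1 i2] /andP[j1 j2].
  apply: val_inj => /=; have [ij|ji|//] := ltngtP i j.
    by have := lt_trans (le_lt_trans (dis _ _ ij) j1) i2; rewrite ltxx.
  by have := lt_trans (le_lt_trans (dis _ _ ji) i1) j2; rewrite ltxx.
Qed.

Lemma negligible_open_cover (N : set R) (e : R) : mu.-negligible N -> 0 < e ->
  exists U : set R, [/\ open U, N `<=` U & (mu U < e%:E)%E].
Proof.
move=> [A [mA A0 NA]] e0.
have Afin : (mu A < +oo)%E by apply: (@le_lt_trans _ _ 0%E); [rewrite -A0|exact: ltry].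
have [U [oU AU UA]] := lebesgue_regularity_outer mA Afin e0.
exists U; split => //; first exact: subset_trans AU.
rewrite -(setDUK AU) (le_lt_trans (outer_measureU2 _ _ _))//.
by rewrite -[X in (X + _ < _)%E]/(mu A) A0 add0e.
Qed.

(** Fix e and cover N by an open set U of measure less than the d that absolute
    continuity gives for e.  On small intervals tagged by a point outside N
    the increment of phi is controlled by that of V up to e times the length;
    small intervals tagged by a point of N lie in U, so their total length is
    less than d and their total increment less than e.  The additive relation Q
    records the list of intervals of the second kind. *)
Lemma ac_increment_le a b (phi V : R -> R) (C p q : R) (N : set R) :
  absolutely_continuous a b phi -> 0 <= C -> a <= p -> p <= q -> q <= b ->
  (forall x y, p <= x -> x <= y -> y <= q -> V x <= V y) ->
  mu.-negligible N ->
  (forall t, p <= t <= q -> ~ N t -> forall e, 0 < e -> exists2 r, 0 < r &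
     forall s, p <= s <= q -> `|s - t| < r ->
     `|phi s - phi t| <= C * `|V s - V t| + e * `|s - t|) ->
  `|phi q - phi p| <= C * (V q - V p).
Proof.
move=> acphi C0 ap pq qb ndV N0 loc; apply/ler_addgt0Pr => e' e'0.
have qp1 : 0 < q - p + 1 by rewrite ltr_wpDl ?subr_ge0.
pose e := e' / (q - p + 1); have e0 : 0 < e by rewrite divr_gt0.
have [d d0 Hd] := ac_seq acphi e0.
have [U [oU NU Ud]] := negligible_open_cover N0 d0.
pose Q x y := exists s : seq (R * R),
  [/\ forall r, r \in s -> [/\ x <= r.1, r.1 <= r.2 & r.2 <= y],
      pairwise (fun p q => p.2 <= q.1) s,
      ((\sum_(r <- s) (r.2 - r.1))%:E <= mu (U `&` `[x, y[%classic))%E &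
      `|phi y - phi x| <= C * (V y - V x) + e * (y - x) +
        \sum_(r <- s) `|phi r.2 - phi r.1|].
have [] : Q p q.
  apply: cousin_induction => //.
    move=> x y z px xy yz zq [s1 [s1xy s1p s1U s1phi]] [s2 [s2xy s2p s2U s2phi]].
    exists (s1 ++ s2); split.
    - move=> r; rewrite mem_cat => /orP[/s1xy|/s2xy] [r1 r2 r3]; split => //.
        exact: le_trans yz.
      exact: le_trans r1.
    - rewrite pairwise_cat s1p s2p !andbT; apply/allrelP => r1 r2.
      by move=> /s1xy[_ _ h1] /s2xy[h2 _ _]; exact: le_trans h2.
    - rewrite big_cat/= EFinD (le_trans (leeD s1U s2U))//.
      rewrite -measureU//=.
      + apply: le_outer_measure => t [[Ut]|[Ut]] /=; rewrite !in_itv/= => /andP[t1 t2].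
          by split => //; rewrite t1 (lt_le_trans t2).
        by split => //; rewrite t2 (le_trans xy).
      + by apply: measurableI => //; exact: open_measurable.
      + by apply: measurableI => //; exact: open_measurable.
      + apply/seteqP; split => // t [[_ /=]]; rewrite !in_itv/= => /andP[_ t1] [_ /andP[t2 _]].
        by move: t1; rewrite ltNge t2.
    - rewrite big_cat/=.
      have -> : phi z - phi x = (phi y - phi x) + (phi z - phi y) by ring.
      by apply: le_trans (ler_normD _ _) _; lra.
  move=> t tpq; have [Nt|nNt] := pselect (N t).
    have /nbhs_ballP[r /= r0 rU] := open_nbhs_nbhs (conj oU (NU _ Nt)).
    exists r => // x y px xt ty yq tx yt; exists [:: (x, y)]; split => //=.
    - by move=> p'; rewrite inE => /eqP ->/=; split => //; exact: le_trans ty.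
    - have -> : U `&` `[x, y[%classic = `[x, y[%classic.
        apply/setIidPr => s /=; rewrite in_itv/= => /andP[s1 s2]; apply: rU.
        by rewrite /ball/= ltr_norml; apply/andP; split; lra.
      rewrite big_seq1 lebesgue_measure_itv/= lte_fin.
      case: ltP => [//|yx]; rewrite lee_fin /=; lra.
    - have xy := le_trans xt ty; have Vxy : V x <= V y by exact: ndV.
      by rewrite big_seq1/= lerDr addr_ge0// mulr_ge0 ?subr_ge0// ltW.
  have [r r0 Hr] := loc t tpq nNt e e0.
  exists r => // x y px xt ty yq tx yt; exists [::]; split => //.
    by rewrite big_nil measure_ge0.
  rewrite big_nil addr0; move/andP: tpq => [pt tq].
  have B1 : `|phi x - phi t| <= C * `|V x - V t| + e * `|x - t|.
    apply: Hr; first by rewrite px (le_trans xt).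
    by rewrite ler0_norm; lra.
  have B2 : `|phi y - phi t| <= C * `|V y - V t| + e * `|y - t|.
    apply: Hr; first by rewrite (le_trans pt).
    by rewrite ger0_norm; lra.
  have Vxt : V x <= V t by exact: ndV.
  have Vty : V t <= V y by exact: ndV.
  rewrite (distrC (phi x)) (distrC (V x)) (distrC x) in B1.
  rewrite (@ger0_norm _ (V t - V x)) ?(@ger0_norm _ (t - x)) ?subr_ge0// in B1.
  rewrite (@ger0_norm _ (V y - V t)) ?(@ger0_norm _ (y - t)) ?subr_ge0// in B2.
  have -> : phi y - phi x = (phi y - phi t) + (phi t - phi x) by ring.
  by apply: le_trans (ler_normD _ _) _; lra.
move=> s [spq sp sU sphi]; apply: le_trans sphi _.
rewrite -addrA lerD2l; apply: (@le_trans _ _ (e * (q - p) + e)).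
  rewrite lerD2l ltW//; apply: Hd => //.
    by move=> r /spq[r1 r2 r3]; split; [exact: le_trans r1|by []|exact: le_trans qb].
  rewrite -lte_fin (le_lt_trans sU)// (le_lt_trans _ Ud)//.
  by apply: le_outer_measure => t [].
by rewrite -[X in _ + X]mulr1 -mulrDr /e divfK// gt_eqF.
Qed.
End absolute_continuity.

Section absolute_continuity_calculus.
Variable R : realType.
Implicit Types (a b : R).

(** Covers sums, products and coordinates at once. *)
Lemma ac_dominated (V1 V2 W : normedModType R) a b (f : R -> V1) (g : R -> V2)
    (h : R -> W) (L : R) : 0 < L ->
  absolutely_continuous a b f -> absolutely_continuous a b g ->
  (forall s t, a <= s <= b -> a <= t <= b ->
     `|h s - h t| <= L * (`|f s - f t| + `|g s - g t|)) ->
  absolutely_continuous a b h.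
Proof.
move=> L0 acf acg H e e0.
have e2 : 0 < e / L / 2 by rewrite !divr_gt0.
have [d1 d10 Hd1] := acf _ e2; have [d2 d20 Hd2] := acg _ e2.
exists (Num.min d1 d2); first by rewrite lt_min d10.
move=> n x y xy tI; rewrite lt_min => /andP[s1 s2].
have B1 := Hd1 n x y xy tI s1; have B2 := Hd2 n x y xy tI s2.
have -> : e = L * (e / L / 2 + e / L / 2) by rewrite -splitr mulrC divfK// gt_eqF.
apply: le_lt_trans
  (_ : _ <= L * (\sum_(i < n) `|f (y i) - f (x i)| +
                 \sum_(i < n) `|g (y i) - g (x i)|)) _.
  rewrite -big_split mulr_sumr/=; apply: ler_sum => i _.
  have [ax [xyi yb]] := xy i.
  by apply: H; apply/andP; split=> //; [exact: le_trans xyi|exact: le_trans yb].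
by rewrite ltr_pM2l// ltrD.
Qed.

Lemma ac_small (V : normedModType R) a b (f : R -> V) : absolutely_continuous a b f ->
  forall e, 0 < e -> exists2 d, 0 < d & forall s t, a <= s <= b -> a <= t <= b ->
  `|s - t| < d -> `|f s - f t| < e.
Proof.
move=> acf e e0; have [d d0 Hd] := ac_seq acf e0; exists d => //.
suff H s t : a <= s -> s <= t -> t <= b -> t - s < d -> `|f t - f s| < e.
  move=> s t /andP[As sb] /andP[At tb]; have [st|ts] := leP s t.
    by rewrite distrC ger0_norm ?subr_ge0// (distrC (f s)); exact: H.
  by rewrite gtr0_norm ?subr_gt0//; apply: H => //; exact: ltW.
move=> As st tb tsd; have := Hd [:: (s, t)]; rewrite !big_seq1; apply => //.
by move=> p; rewrite inE => /eqP ->.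
Qed.

Lemma ac_bounded (V : normedModType R) a b (f : R -> V) : a <= b ->
  absolutely_continuous a b f ->
  exists M, 0 <= M /\ forall t, a <= t <= b -> `|f t| <= M.
Proof.
move=> ab acf.
apply: (@cousin_induction _ a b (fun x y =>
  exists M, 0 <= M /\ forall t, x <= t <= y -> `|f t| <= M)) => //.
  move=> x y z ax xy yz zb [M1 [M10 H1]] [M2 [M20 H2]]; exists (M1 + M2); split.
    exact: addr_ge0.
  move=> t /andP[xt tz]; have [ty|yt] := leP t y.
    by rewrite (le_trans (H1 t _)) ?xt// lerDl.
  by rewrite (le_trans (H2 t _)) ?tz ?(ltW yt)// lerDr.
have [d d0 Hd] := ac_small acf ltr01.
move=> t tab; exists d => // x y ax xt ty yb tx yt; exists (`|f t| + 1); split.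
  by rewrite addr_ge0.
move=> s /andP[xs sy].
rewrite -[f s](subrK (f t)) addrC (le_trans (ler_normD _ _))// lerD2l ltW//.
apply: Hd => //; first by rewrite (le_trans ax)// (le_trans sy).
by rewrite ltr_norml; apply/andP; split; lra.
Qed.

Lemma ac_id a b : absolutely_continuous a b (fun t : R => t).
Proof.
move=> e e0; exists e => // n x y xy _; apply: le_lt_trans.
by apply: ler_sum => i _; have [_ [xyi _]] := xy i; rewrite ger0_norm// subr_ge0.
Qed.

Lemma ac_add a b (f g : R -> R) : absolutely_continuous a b f ->
  absolutely_continuous a b g -> absolutely_continuous a b (fun t => f t + g t).
Proof.
move=> acf acg; apply: (@ac_dominated _ _ _ _ _ f g _ 1) => // s t _ _.
rewrite mul1r; have -> : f s + g s - (f t + g t) = (f s - f t) + (g s - g t) by ring.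
exact: ler_normD.
Qed.

Lemma ac_mul a b (f g : R -> R) : a <= b -> absolutely_continuous a b f ->
  absolutely_continuous a b g -> absolutely_continuous a b (fun t => f t * g t).
Proof.
move=> ab acf acg; have [M1 [M10 H1]] := ac_bounded ab acf.
have [M2 [M20 H2]] := ac_bounded ab acg.
apply: (@ac_dominated _ _ _ _ _ f g _ (M1 + M2 + 1)) => //; first by rewrite ltr_wpDl// addr_ge0.
move=> s t sab tab.
have -> : f s * g s - f t * g t = (f s - f t) * g s + f t * (g s - g t) by ring.
apply: le_trans (ler_normD _ _) _; rewrite !normrM mulrDr.
apply: lerD.
  by rewrite mulrC ler_wpM2r// (le_trans (H2 _ _))//; lra.
by rewrite ler_wpM2r// (le_trans (H1 _ _))//; lra.
Qed.

Lemma ac_cst a b (c : R) : absolutely_continuous a b (fun=> c).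
Proof.
apply: (@ac_dominated _ _ _ _ _ _ _ _ 1 _ (@ac_id a b) (@ac_id a b)) => // s t _ _.
by rewrite subrr normr0 mulr_ge0.
Qed.

Lemma ac_total_variation_small a b (f : R -> R) : absolutely_continuous a b f ->
  forall e, 0 < e -> exists2 d, 0 < d & forall x y, a <= x -> x <= y -> y <= b ->
  y - x < d -> (total_variation x y f <= e%:E)%E.
Proof.
move=> acf e e0; have [d d0 Hd] := acf e e0; exists d => // x y ax xy yb yxd.
apply: ge_ereal_sup => _ [_ [s xys <-] <-]; rewrite lee_fin.
rewrite /variation big_mkord ltW//.
have sm (i j : nat) : (i <= j)%N -> (j <= size s)%N -> nth y (x :: s) i <= nth y (x :: s) j.
  move=> ij js; apply: (sorted_leq_nth (@le_trans _ R) (@le_refl _ R)); rewrite ?inE//=.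
  - by case: xys => /(sub_path (@ltW _ R)).
  - by rewrite ltnS (leq_trans ij).
have sx : nth y (x :: s) 0 = x by [].
have sy : nth y (x :: s) (size s) = y.
  exact: (itv_partition_nth_size _ xys).
apply: (Hd (size s) (fun i => nth y (x :: s) i) (fun i => nth y (x :: s) i.+1)).
- move=> i; split; [|split].
  + by rewrite (le_trans ax)// -{1}sx sm// ltnW.
  + by apply: sm.
  + by rewrite (le_trans _ yb)// -[leRHS]sy sm.
- have dis (i j : 'I_(size s)) : (i < j)%N -> nth y (x :: s) i.+1 <= nth y (x :: s) j.
    by move=> ij; apply: sm => //; exact: ltnW.
  move=> i j _ _ [t []]; rewrite /= !in_itv => /andP[i1 i2] /andP[j1 j2].
  apply: val_inj => /=; have [ij|ji|//] := ltngtP i j.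
    by have := lt_trans (le_lt_trans (dis _ _ ij) j1) i2; rewrite ltxx.
  by have := lt_trans (le_lt_trans (dis _ _ ji) i1) j2; rewrite ltxx.
- rewrite -(big_mkord xpredT (fun i => nth y (x :: s) i.+1 - nth y (x :: s) i)).
  by rewrite telescope_sumr// sy.
Qed.

(** V is the total variation over [a, t].  Absolute continuity bounds every
    variation sum over a short interval by e; this gives the uniform continuity
    of V, and its finiteness by Cousin's lemma. *)
Lemma ac_variation_function a b (f : R -> R) : a <= b -> absolutely_continuous a b f ->
  exists V : R -> R,
    (forall x y, a <= x -> x <= y -> y <= b -> `|f y - f x| <= V y - V x) /\
    forall e, 0 < e -> exists2 d, 0 < d & forall x y, a <= x -> x <= y -> y <= b ->
      y - x < d -> V y - V x <= e.
Proof.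
move=> ab acf.
have fin : total_variation a b f \is a fin_num.
  apply: (@cousin_induction _ a b (fun x y => total_variation x y f \is a fin_num)) => //.
    move=> x y z ax xy yz zb h1 h2.
    by rewrite (total_variationD f xy yz) fin_numD h1.
  have [d d0 Hd] := ac_total_variation_small acf ltr01.
  move=> t _; exists (d / 2); first by rewrite divr_gt0.
  move=> x y ax xt ty yb tx yt; have xy := le_trans xt ty.
  have := Hd x y ax xy yb; rewrite ge0_fin_numE ?total_variation_ge0// => H.
  by apply: le_lt_trans (H _) (ltry _); lra.
have fin' x y : a <= x -> x <= y -> y <= b -> total_variation x y f \is a fin_num.
  move=> ax xy yb; move: fin; rewrite (total_variationD f (le_trans ax xy) yb).
  rewrite fin_numD => /andP[+ _]; rewrite (total_variationD f ax xy).
  by rewrite fin_numD => /andP[].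
exists (fun t => fine (total_variation a t f)).
have E x y : a <= x -> x <= y -> y <= b ->
    (fine (total_variation a y f) - fine (total_variation a x f))%:E = total_variation x y f.
  move=> ax xy yb; have xb := le_trans xy yb; have ay := le_trans ax xy.
  rewrite EFinB !fineK ?fin'//; rewrite (total_variationD f ax xy).
  by rewrite addeAC subee ?add0e// fin'.
split.
  by move=> x y ax xy yb; rewrite -lee_fin E//; exact: total_variation_ge.
move=> e e0; have [d d0 Hd] := ac_total_variation_small acf e0.
by exists d => // x y ax xy yb yxd; rewrite -lee_fin E//; exact: Hd.
Qed.

End absolute_continuity_calculus.

(** * Uniform behaviour off a set of small measure *)

Section lusin_sets.
Variable R : realType.
Implicit Types (a b : R) (K U N C : set R).
Local Notation mu := (@lebesgue_measure R).

Lemma measure_small_tail (W : nat -> set R) (e : R) : (mu (W 0%N) < +oo)%E ->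
  (forall n, measurable (W n)) -> (forall n, W n.+1 `<=` W n) ->
  \bigcap_n W n = set0 -> 0 < e -> exists n, (mu (W n) < e%:E)%E.
Proof.
move=> W0 mW dW cW e0.
have dW' : {homo W : n m / (n <= m)%N >-> (m <= n)%O}.
  by apply/nonincreasing_seqP => n; apply/subsetPset; exact: dW.
have : (mu \o W) x @[x --> \oo] --> 0%E.
  rewrite -(@measure0 _ _ _ mu) -cW; apply: nonincreasing_cvg_mu => //.
  by rewrite cW; exact: measurable0.
move=> /fine_cvgP[[n0 _ Wfin]] /cvgrPdist_lt /(_ _ e0)[n1 _ H].
exists (maxn n0 n1); have := H _ (leq_maxr n0 n1).
rewrite sub0r normrN /= => h; rewrite -[mu _]fineK ?lte_fin; last exact: Wfin _ (leq_maxl _ _).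
exact: le_lt_trans (ler_norm _) h.
Qed.

Lemma measure_small_bigcup (W : nat -> set R) (e : R) : 0 < e ->
  (forall n, measurable (W n)) -> (forall n, (mu (W n) < (e / (2 ^ n.+1)%:R)%:E)%E) ->
  (mu (\bigcup_n W n) <= e%:E)%E.
Proof.
move=> e0 mW We.
apply: le_trans (@measure_sigma_subadditive _ R _ mu _ W mW
  (bigcup_measurable (fun k _ => mW k)) (@subset_refl _ _)) _.
apply: le_trans; last by apply: (epsilon_trick0 xpredT); exact: ltW.
by apply: lee_nneseries => n _; [move=> _; exact: measure_ge0|exact: (ltW (We n))].
Qed.

Lemma compact_subset_off C U N : measurable C -> measurable U -> (mu U < mu C)%E ->
  mu.-negligible N ->
  exists K, [/\ compact K, K `<=` C, (forall t, K t -> ~ U t /\ ~ N t) & (0 < mu K)%E].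
Proof.
move=> mC mU UC [A [mA A0 NA]].
pose D := C `\` (U `|` A).
have mD : measurable D by apply: measurableD => //; exact: measurableU.
have : (0 < mu D)%E.
  rewrite lt0e measure_ge0 andbT; apply/eqP => D0.
  suff : (mu C <= mu U)%E by rewrite leNgt UC.
  apply: (@le_trans _ _ (mu (D `|` (U `|` A)))).
    by apply: le_outer_measure => t Ct; case: (pselect ((U `|` A) t)); [right|left].
  apply: le_trans (outer_measureU2 _ _ _) _.
  apply: le_trans (leeD2l _ (outer_measureU2 _ _ _)) _.
  by rewrite -[X in (X + _ <= _)%E]/(mu D) D0 add0e -[X in (_ + X <= _)%E]/(mu A) A0 adde0.
rewrite lebesgue_regularity_inner_sup// => /ereal_sup_gt[_ [K [cK KD] <-] K0].
exists K; split => // t /KD[]// Ct /not_orP[nU nA]; split => // Nt.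
by apply: nA; exact: NA.
Qed.

Lemma continuous_clamp a b (f : R -> R) :
  (forall e, 0 < e -> exists2 d, 0 < d & forall s t, a <= s <= b -> a <= t <= b ->
     `|s - t| < d -> `|f s - f t| < e) -> a <= b ->
  continuous (fun y => f (Num.max a (Num.min b y))).
Proof.
move=> cf ab t; apply/continuous_at_epsP => e /cf[d d0 Hd]; exists d => // y yt.
have clampab x : a <= Num.max a (Num.min b x) <= b.
  by rewrite le_max lexx ge_max ab ge_min lexx.
apply/ltW/Hd => //; apply: le_lt_trans yt.
by rewrite /Num.max /Num.min; case: ifP; case: ifP; case: ifP; case: ifP => *;
  rewrite ler_norml; apply/andP; split; have := normr_ge0 (y - t); have := ler_norm (y - t);
  have := ler_norm (t - y); rewrite (distrC t); lra.
Qed.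

(** The set D n k of points where difference quotients with increments below
    1/(k+1) differ by at most 1/(n+1) is closed when f is continuous, and for
    fixed n these sets exhaust the points of differentiability as k grows.
    Requiring the quotients to be close to each other, instead of close to f',
    is what makes D n k closed without any knowledge of f'. *)
Lemma uniform_derivative_off_small a b (f f' : R -> R) N (e : R) : a <= b ->
  (forall e, 0 < e -> exists2 d, 0 < d & forall s t, a <= s <= b -> a <= t <= b ->
     `|s - t| < d -> `|f s - f t| < e) ->
  mu.-negligible N ->
  (forall t, a < t < b -> ~ N t -> is_derive t 1 f (f' t)) -> 0 < e ->
  exists U, [/\ measurable U, (mu U <= e%:E)%E &
    forall eta, 0 < eta -> exists2 r, 0 < r & forall t, a < t < b -> ~ N t -> ~ U t ->
    forall s, a <= s <= b -> `|s - t| < r ->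
    `|f s - f t - f' t * (s - t)| <= eta * `|s - t|].
Proof.
move=> ab cf [A [mA A0 NA]] df e0.
have inv_gt0 k : 0 < k.+1%:R^-1 :> R by rewrite invr_gt0.
pose g y := f (Num.max a (Num.min b y)).
have gE y : a <= y <= b -> g y = f y.
  by move=> /andP[ay yb]; rewrite /g (min_idPr yb) (max_idPr ay).
have cg : continuous g by exact: continuous_clamp.
pose D (n k : nat) := [set t | a <= t <= b /\ forall s s', a <= s <= b -> a <= s' <= b ->
  `|s - t| < k.+1%:R^-1 -> `|s' - t| < k.+1%:R^-1 ->
  `|(f s - f t) * (s' - t) - (f s' - f t) * (s - t)| <= n.+1%:R^-1 * (`|s - t| * `|s' - t|)].
have cD n k : closed (D n k).
  have -> : D n k = `[a, b]%classic `&`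
      \bigcap_(p in [set p : R * R | a <= p.1 <= b /\ a <= p.2 <= b])
      ([set t | k.+1%:R^-1 <= `|p.1 - t|] `|` [set t | k.+1%:R^-1 <= `|p.2 - t|] `|`
       [set t | `|(g p.1 - g t) * (p.2 - t) - (g p.2 - g t) * (p.1 - t)| -
                 n.+1%:R^-1 * (`|p.1 - t| * `|p.2 - t|) <= 0]).
    apply/seteqP; split => [t [tab Dt]|t [/=]].
      split; first by rewrite /= in_itv.
      move=> [s s'] [/= sab s'ab].
      have [st|] := ltP `|s - t| k.+1%:R^-1; last by left; left.
      have [s't|] := ltP `|s' - t| k.+1%:R^-1; last by left; right.
      by right; rewrite /= !gE// subr_le0; exact: Dt.
    rewrite in_itv => tab H; split => // s s' sab s'ab st s't.
    have [|[/=|/=]|/=] := H (s, s'); first by split.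
    - by rewrite leNgt st.
    - by rewrite leNgt s't.
    - by rewrite !gE// subr_le0.
  apply: closedI; first exact: interval_closed.
  apply: closed_bigI => -[s s'] /= _; apply: closedU; first apply: closedU.
  - apply: (@preimage_closed _ _ (fun t => `|s - t|) [set x | k.+1%:R^-1 <= x]).
      by move=> y _; apply: cvg_norm; apply: cvgB; [exact: cvg_cst|exact: cvg_id].
    exact: closed_ge.
  - apply: (@preimage_closed _ _ (fun t => `|s' - t|) [set x | k.+1%:R^-1 <= x]).
      by move=> y _; apply: cvg_norm; apply: cvgB; [exact: cvg_cst|exact: cvg_id].
    exact: closed_ge.
  - apply: (@preimage_closed _ _ (fun t => `|(g s - g t) * (s' - t) - (g s' - g t) * (s - t)| -
                 n.+1%:R^-1 * (`|s - t| * `|s' - t|)) [set x | x <= 0]); last exact: closed_le.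
    have cB (u : R) : continuous (fun t => u - t).
      by move=> y; apply: cvgB; [exact: cvg_cst|exact: cvg_id].
    have cgB (u : R) : continuous (fun t => u - g t).
      by move=> y; apply: cvgB; [exact: cvg_cst|exact: cg].
    move=> y _; apply: cvgB.
      by apply: cvg_norm; apply: cvgB; apply: cvgM; (exact: cB || exact: cgB).
    by apply: cvgM; [exact: cvg_cst|apply: cvgM; apply: cvg_norm; exact: cB].
pose W n k := `]a, b[%classic `\` (D n k `|` A).
have mW n k : measurable (W n k).
  by apply: measurableD => //; apply: measurableU => //; exact: closed_measurable.
have Wsmall n : exists k, (mu (W n k) < (e / 2 / (2 ^ n.+1)%:R)%:E)%E.
  apply: measure_small_tail => //.
  - apply: (@le_lt_trans _ _ (mu `]a, b[%classic)); first by apply: le_outer_measure => t [].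
    by rewrite lebesgue_measure_itv/=; case: ifP => _; rewrite ?ltry.
  - move=> k t [tab nDA]; split => // -[Dt|At]; apply: nDA; [left|by right].
    have kk : k.+2%:R^-1 <= k.+1%:R^-1 :> R by rewrite lef_pV2 ?posrE// ler_nat.
    case: Dt => tab' Dt; split => // s s' sab s'ab st s't; apply: Dt => //.
      exact: lt_le_trans kk.
    exact: lt_le_trans kk.
  - apply/seteqP; split => // t Wt; have [+ nDA] := Wt 0%N I.
    rewrite /= in_itv/= => tab.
    have nNt : ~ N t by move=> /NA At; apply: nDA; right.
    have n2 : 0 < n.+1%:R^-1 / 2 :> R by rewrite divr_gt0.
    have [d d0 Hd] := (is_derive_epsP _ _ _).1 (df t tab nNt) _ n2.
    have [k kd] : exists k, k.+1%:R^-1 < d.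
      by have [k _ /(_ _ (leqnn k))] := near_infty_natSinv_lt (PosNum d0); exists k.
    have [_ []] := Wt k I; left; split; first by move/andP: tab => [ta tb]; rewrite !ltW.
    move=> s s' sab s'ab st s't.
    have B1 := Hd s (lt_trans st kd); have B2 := Hd s' (lt_trans s't kd).
    rewrite /GRing.scale/= in B1 B2.
    have -> : (f s - f t) * (s' - t) - (f s' - f t) * (s - t) =
      (f s - f t - (s - t) * f' t) * (s' - t) - (f s' - f t - (s' - t) * f' t) * (s - t) by ring.
    apply: le_trans (ler_normB _ _) _; rewrite !normrM.
    apply: le_trans (lerD (ler_wpM2r (normr_ge0 _) B1) (ler_wpM2r (normr_ge0 _) B2)) _.
    by rewrite le_eqVlt; apply/orP; left; apply/eqP; move: (n.+1%:R^-1) => c; field.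
  - by rewrite !divr_gt0// ltr0n expn_gt0.
have /boolp.choice[k Hk] := Wsmall.
exists ((\bigcup_n W n (k n)) `|` A); split.
- by apply: measurableU => //; exact: bigcup_measurable.
- apply: le_trans (outer_measureU2 _ _ _) _.
  rewrite -[X in (_ + X <= _)%E]/(mu A) A0 adde0.
  apply: (@le_trans _ _ (e / 2)%:E); last by rewrite lee_fin; lra.
  by apply: measure_small_bigcup => //; rewrite divr_gt0.
move=> eta eta0.
have [n neta] : exists n, n.+1%:R^-1 < eta.
  by have [n _ /(_ _ (leqnn n))] := near_infty_natSinv_lt (PosNum eta0); exists n.
exists (k n).+1%:R^-1 => // t tab nNt /not_orP[nWt nAt] s sab st.
have [_ Dt] : D n (k n) t.
  apply: contrapT => nDt; apply: nWt; exists n => //; split; first by rewrite /= in_itv.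
  by case.
(* Compare the quotient at s with the quotient at t + h, and let t + h be so
   close to t that the latter is within eps / (|s - t| + 1) of f' t. *)
apply/ler_addgt0Pr => eps eps0.
have st1 : 0 < `|s - t| + 1 by rewrite ltr_wpDl.
have epsst : 0 < eps / (`|s - t| + 1) by rewrite divr_gt0.
have [d d0 Hd] := (is_derive_epsP _ _ _).1 (df t tab nNt) _ epsst.
have /andP[At tb] := tab.
pose h := Num.min (Num.min d (k n).+1%:R^-1) (b - t) / 2.
have h0 : 0 < h by rewrite divr_gt0// !lt_min d0 subr_gt0 tb inv_gt0.
have : h * 2 <= Num.min (Num.min d (k n).+1%:R^-1) (b - t) by rewrite divfK.
rewrite !le_min => /andP[/andP[hd hk] hb].
have hn : `|t + h - t| = h by rewrite addrAC subrr add0r gtr0_norm.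
have B1 : `|f (t + h) - f t - (t + h - t) *: f' t| <= eps / (`|s - t| + 1) * h.
  by have := Hd (t + h); rewrite hn; apply; lra.
have B2 := Dt s (t + h) sab.
have {}B2 : `|(f s - f t) * (t + h - t) - (f (t + h) - f t) * (s - t)| <=
    n.+1%:R^-1 * (`|s - t| * h).
  rewrite hn in B2; apply: B2 => //; first by lra.
  by apply: lt_le_trans hk; rewrite ltr_pMr// ltr1n.
rewrite -(ler_pM2r h0) -{1}hn -normrM.
have -> : (f s - f t - f' t * (s - t)) * (t + h - t) =
  ((f s - f t) * (t + h - t) - (f (t + h) - f t) * (s - t)) +
  (f (t + h) - f t - (t + h - t) *: f' t) * (s - t) by rewrite /GRing.scale/=; ring.
apply: le_trans (ler_normD _ _) _; rewrite normrM.
apply: le_trans (lerD B2 (ler_wpM2r (normr_ge0 _) B1)) _.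
rewrite mulrDl; apply: lerD.
  by rewrite mulrA ler_pM2r// ler_wpM2r// ltW.
rewrite mulrAC ler_pM2r// mulrAC ler_pdivrMr// ler_pM2l//; lra.
Qed.

(** A maximal inequality without covering lemma.  The set G where the bound
    holds is closed.  For a compact K missing G, real induction shows that the
    measure of K in [a, x[ is at most (V x - V a) / M: at a point of K one jumps
    to some s with V s - V t > M (s - t), elsewhere K is locally empty. *)
Lemma right_lipschitz_off_small a b (V : R -> R) (e : R) : a <= b ->
  (forall x y, a <= x -> x <= y -> y <= b -> V x <= V y) ->
  (forall e, 0 < e -> exists2 d, 0 < d & forall x y, a <= x -> x <= y -> y <= b ->
      y - x < d -> V y - V x <= e) -> 0 < e ->
  exists M U, [/\ 0 < M, measurable U, (mu U <= e%:E)%E &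
    forall t s, a <= t -> t <= s -> s <= b -> ~ U t -> V s - V t <= M * (s - t)].
Proof.
move=> ab ndV cV e0; have Vab : V a <= V b by exact: ndV.
(* Any M with (V b - V a) / M <= e would do; the 1 keeps M positive. *)
pose M := (V b - V a + 1) / e.
have M0 : 0 < M by rewrite divr_gt0// ltr_wpDl// subr_ge0.
pose G := [set t | a <= t <= b /\ forall s, t <= s <= b -> V s - V t <= M * (s - t)].
have cG : closed G.
  apply: closed_epsP => t Ht.
  have tab : a <= t <= b.
    apply/andP; split; rewrite leNgt; apply/negP => h.
      have [|y [/andP[ay yb] _]] := Ht (a - t); first by rewrite subr_gt0.
      by rewrite ltr_norml; lra.
    have [|y [/andP[ay yb] _]] := Ht (t - b); first by rewrite subr_gt0.
    by rewrite ltr_norml; lra.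
  split => // s /andP[]; rewrite le_eqVlt => /predU1P[<- _|ts sb].
    by rewrite !subrr mulr0.
  move/andP: tab => [At tb].
  apply/ler_addgt0Pr => eps eps0; have eps2 : 0 < eps / 2 by rewrite divr_gt0.
  have [d d0 Hd] := cV _ eps2.
  have [|y [/andP[ay yb] Gy]] := Ht (Num.min (Num.min d (s - t)) (eps / 2 / M)).
    by rewrite !lt_min d0 subr_gt0 ts divr_gt0.
  rewrite !lt_min !ltr_norml => /andP[/andP[/andP[y1 y2] /andP[y3 y4]] /andP[y5 y6]].
  have ys : y <= s by lra.
  have := Gy s; rewrite ys sb => /(_ isT) B1.
  have B2 : V y - V t <= eps / 2.
    have [yt|ty] := leP y t.
      by have := ndV _ _ ay yt tb; lra.
    by apply: Hd => //; lra.
  have B3 : M * (t - y) <= eps / 2 by rewrite mulrC -ler_pdivlMr//; lra.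
  have : M * (s - y) = M * (s - t) + M * (t - y) by ring.
  lra.
exists M, (`[a, b]%classic `\` G); split => //.
- by apply: measurableD => //; exact: closed_measurable.
- rewrite lebesgue_regularity_inner_sup; last first.
    by apply: measurableD => //; exact: closed_measurable.
  apply: ge_ereal_sup => _ [K [cK KG] <-].
  have clK : closed K by apply: compact_closed => //; exact: Rhausdorff.
  have mK : measurable K by exact: closed_measurable.
  have Kab t : K t -> a <= t < b.
    move=> /KG[/=]; rewrite in_itv/= => /andP[ta tb] nG; rewrite ta lt_neqAle tb andbT.
    apply/eqP => e'; apply: nG; split; first by rewrite ta tb.
    move=> s; rewrite e' => /andP[bs sb].
    have -> : s = b by apply/eqP; rewrite eq_le sb.
    by rewrite !subrr mulr0.
  have Kco x y : a <= x -> x <= y -> (mu (K `&` `[a, y[) <= mu (K `&` `[a, x[) + (y - x)%:E)%E.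
    move=> ax xy; apply: (@le_trans _ _ (mu ((K `&` `[a, x[) `|` `[x, y[))%E).
      apply: le_outer_measure => t [Kt /=]; rewrite !in_itv/= => /andP[at' ty].
      have [xt|tx] := leP x t; first by right.
      by left; rewrite at'.
    apply: le_trans (outer_measureU2 _ _ _) _; rewrite leeD2l//.
    rewrite -[X in (X <= _)%E]/(mu `[x, y[%classic) lebesgue_measure_itv/= lte_fin.
    by case: ltP => // _; rewrite lee_fin subr_ge0.
  suff H : (mu (K `&` `[a, b[) <= ((V b - V a) / M)%:E)%E.
    have -> : K = K `&` `[a, b[%classic.
      by apply/esym/setIidPl => t /Kab; rewrite /= in_itv/=.
    apply: le_trans H _; rewrite lee_fin ler_pdivrMr//.
    by rewrite /M mulrCA mulfV ?gt_eqF// mulr1 lerDl.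
  apply: (@real_induction _ a b (fun x => (mu (K `&` `[a, x[) <= ((V x - V a) / M)%:E)%E)) => //.
  + by rewrite set_itvco0// setI0 measure0 subrr mul0r.
  + move=> t /andP[At tb] Pt; have [Kt|nKt] := pselect (K t).
      have [_ nG] := KG _ Kt.
      have [s [/andP[ts sb] Vs]] : exists s, t <= s <= b /\ M * (s - t) < V s - V t.
        apply: contrapT => h; apply: nG; split; first by rewrite At ltW.
        by move=> s tsb; rewrite leNgt; apply/negP => h'; apply: h; exists s.
      have ts' : t < s.
        by rewrite lt_neqAle ts andbT; apply/eqP => e'; move: Vs; rewrite e' !subrr mulr0 ltxx.
      exists s; first by rewrite ts' sb.
      apply: le_trans (Kco _ _ At ts) _; apply: le_trans (leeD2r _ Pt) _.
      rewrite -EFinD lee_fin.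
      rewrite ler_pdivlMr// mulrDl divfK ?gt_eqF//; lra.
    have : nbhs t (~` K) by apply: open_nbhs_nbhs; split => //; exact: closed_openC.
    move=> /nbhs_ballP[r /= r0 rK].
    exists (Num.min b (t + r / 2)).
      by rewrite lt_min tb ltrDl divr_gt0// ge_min lexx.
    have tt' : t <= Num.min b (t + r / 2) by rewrite le_min ltW// lerDl divr_ge0// ltW.
    apply: (@le_trans _ _ (mu (K `&` `[a, t[))).
      apply: le_outer_measure => s [Ks /=]; rewrite !in_itv/= lt_min => /and3P[As sb st].
      split => //; rewrite As /= ltNge; apply/negP => ts.
      by apply: (rK s) => //; rewrite /ball/= ltr_norml; apply/andP; split; lra.
    apply: le_trans Pt _; rewrite lee_fin ler_pM2r ?invr_gt0// lerD2r.
    by apply: ndV => //; rewrite ge_min lexx.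
  + move=> t /andP[At tb] H; apply/lee_addgt0Pr => eps eps0.
    have [s As [/andP[ts st] Ps]] := H _ eps0.
    apply: le_trans (Kco _ _ As st) _; apply: leeD.
      apply: le_trans Ps _; rewrite lee_fin ler_pM2r ?invr_gt0// lerD2r.
      exact: ndV.
    by rewrite lee_fin; lra.
- move=> t s At ts sb nU; have [_ H] : G t.
    apply: contrapT => nG; apply: nU; split => //=.
    by rewrite in_itv/= At (le_trans ts).
  by apply: H; rewrite ts.
Qed.
End lusin_sets.

Section dichotomy.
Variable R : realType.
Local Notation mu := (@lebesgue_measure R).

(** Where f' is nonzero, f expands distances from t by a factor 1/(k+1) within
    some interval with rational endpoints.  Restricting both points to that
    interval gives countably many closed sets which cover these t, and on each
    of them f is expanding for all pairs of points. *)
Lemma derivative_dichotomy (a b : R) (f f' : R -> R) (N : set R) : a <= b ->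
  (forall e, 0 < e -> exists2 d, 0 < d & forall s t, a <= s <= b -> a <= t <= b ->
     `|s - t| < d -> `|f s - f t| < e) ->
  (forall t, a < t < b -> ~ N t -> is_derive t 1 f (f' t)) ->
  mu.-negligible [set t | [/\ a < t < b, ~ N t & f' t != 0]] \/
  exists C c, [/\ closed C, C `<=` `[a, b]%classic, (0 < mu C)%E, 0 < c &
    forall s t, C s -> C t -> c * `|s - t| <= `|f s - f t|].
Proof.
move=> ab cf df.
pose g y := f (Num.max a (Num.min b y)).
have gE y : a <= y <= b -> g y = f y.
  by move=> /andP[ay yb]; rewrite /g (min_idPr yb) (max_idPr ay).
have cg : continuous g by exact: continuous_clamp.
pose B (p : nat * (rat * rat)) := [set t | [/\ a <= t <= b, ratr p.2.1 <= t <= ratr p.2.2 &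
  forall s, a <= s <= b -> ratr p.2.1 <= s <= ratr p.2.2 ->
    p.1.+1%:R^-1 * `|s - t| <= `|f s - f t|]].
have cB p : closed (B p).
  have -> : B p = (`[a, b]%classic `&` `[ratr p.2.1, ratr p.2.2]%classic) `&`
     \bigcap_(s in [set s | a <= s <= b /\ ratr p.2.1 <= s <= ratr p.2.2])
       [set t | p.1.+1%:R^-1 * `|s - t| - `|g s - g t| <= 0].
    apply/seteqP; split => [t [tab tp H]|t [/= []]].
      split; first by split; rewrite /= in_itv.
      by move=> s [sab sp] /=; rewrite !gE// subr_le0; exact: H.
    rewrite !in_itv => tab tp H; split => // s sab sp.
    by have := H s (conj sab sp); rewrite /= !gE// subr_le0.
  apply: closedI; first by apply: closedI; exact: interval_closed.
  apply: closed_bigI => s _.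
  apply: (@preimage_closed _ _ (fun t => p.1.+1%:R^-1 * `|s - t| - `|g s - g t|)
    [set x | x <= 0]); last exact: closed_le.
  move=> y _; apply: cvgB.
    by apply: cvgM; [exact: cvg_cst|apply: cvg_norm; apply: cvgB; [exact: cvg_cst|exact: cvg_id]].
  by apply: cvg_norm; apply: cvgB; [exact: cvg_cst|exact: cg].
have [[p Bp]|nB] := pselect (exists p, (0 < mu (B p))%E).
  right; exists (B p), p.1.+1%:R^-1; split => //.
  - by move=> t [tab _ _]; rewrite /= in_itv.
  - by move=> s t [sab sp _] [tab tp H]; exact: H.
left.
pose F n := if unpickle n is Some p then B p else set0.
have F0 n : mu.-negligible (F n).
  rewrite /F; case: unpickle => [p|]; last exact: negligible_set0.
  exists (B p); split => //; first exact: closed_measurable.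
  by apply/eqP; rewrite -measure_le0 leNgt; apply/negP => h; apply: nB; exists p.
apply: negligibleS (negligible_bigcup F0) => t [tab nNt f't].
have f2 : 0 < `|f' t| / 2 by rewrite divr_gt0// normr_gt0.
have [d d0 Hd] := (is_derive_epsP _ _ _).1 (df t tab nNt) _ f2.
have [k kf] : exists k, k.+1%:R^-1 < `|f' t| / 2.
  by have [k _ /(_ _ (leqnn k))] := near_infty_natSinv_lt (PosNum f2); exists k.
have [|q] := @rat_in_itvoo R (t - d) t; first by rewrite ltrBlDr ltrDl.
rewrite in_itv/= => /andP[q1 q2].
have [|r] := @rat_in_itvoo R t (t + d); first by rewrite ltrDl.
rewrite in_itv/= => /andP[r1 r2].
exists (pickle (k, (q, r))) => //; rewrite /F pickleK; split => /=.
- by move/andP: tab => [ta tb]; rewrite !ltW.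
- by rewrite !ltW.
move=> s sab /andP[qs sr].
have := Hd s; rewrite /GRing.scale/= => /(_ ltac:(rewrite ltr_norml; apply/andP; split; lra)) H.
have B1 : `|(s - t) * f' t| <= `|f s - f t| + `|f s - f t - (s - t) * f' t|.
  rewrite -{1}[(s - t) * f' t](subKr (f s - f t)).
  exact: ler_normB.
have B2 : k.+1%:R^-1 * `|s - t| <= `|f' t| / 2 * `|s - t| by rewrite ler_wpM2r// ltW.
by apply: le_trans B2 _; rewrite normrM in B1; lra.
Qed.
End dichotomy.

(** * Taylor expansion along an absolutely continuous function *)

Section derivative_rules.
Variable R : realType.
Implicit Types (f g : R -> R) (t : R).

(** The rules on lambda-abstractions, which chain by unification on
    polynomial expressions in several functions. *)
Lemma is_derive_add f g t df dg : is_derive t 1 f df -> is_derive t 1 g dg ->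
  is_derive t 1 (fun x => f x + g x) (df + dg).
Proof. by move=> ? ?; exact: is_deriveD. Qed.

Lemma is_derive_mul f g t df dg : is_derive t 1 f df -> is_derive t 1 g dg ->
  is_derive t 1 (fun x => f x * g x) (df * g t + f t * dg).
Proof.
move=> hf hg; have := is_deriveM hf hg; rewrite /GRing.scale/= addrC.
by rewrite [g t * df]mulrC.
Qed.

Lemma is_derive_const (c : R) t : is_derive t 1 (fun=> c) 0.
Proof. exact: is_derive_cst. Qed.

Lemma is_derive_scale (c : R) f t df : is_derive t 1 f df ->
  is_derive t 1 (fun x => c * f x) (c * df).
Proof.
by move=> h; have := is_derive_mul (is_derive_const c t) h; rewrite mul0r add0r.
Qed.

Lemma is_derive_sub f g t df dg : is_derive t 1 f df -> is_derive t 1 g dg ->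
  is_derive t 1 (fun x => f x - g x) (df - dg).
Proof.
by move=> ? ?; exact: is_deriveB.
Qed.

Lemma is_derive_congr f t df dg : is_derive t 1 f df -> df = dg -> is_derive t 1 f dg.
Proof. by move=> h <-. Qed.

Lemma ac_scale (a b c : R) f : a <= b -> absolutely_continuous a b f ->
  absolutely_continuous a b (fun t => c * f t).
Proof. by move=> ab acf; apply: ac_mul => //; exact: ac_cst. Qed.

Lemma ac_sub (a b : R) f g : a <= b -> absolutely_continuous a b f ->
  absolutely_continuous a b g -> absolutely_continuous a b (fun t => f t - g t).
Proof.
move=> ab acf acg; apply: (@ac_dominated _ _ _ _ _ _ f g _ 1) => // s t _ _.
rewrite mul1r; have -> : f s - g s - (f t - g t) = (f s - f t) - (g s - g t) by ring.
exact: ler_normB.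
Qed.

End derivative_rules.

Section jets.
Variable R : realType.
Local Notation mu := (@lebesgue_measure R).

Lemma negligible_set1 (x : R) : mu.-negligible [set x].
Proof. by exists [set x]; split => //; exact: lebesgue_measure_set1. Qed.

Lemma negligible_endpoints (a b : R) (N : set R) : mu.-negligible N ->
  mu.-negligible (N `|` [set a; b]).
Proof. by move=> N0; do !apply: negligibleU => //; exact: negligible_set1. Qed.

(** The inequality between the integral of g df and C times the variation
    of f. *)
Lemma ac_derivative_increment_le (a b : R) (f phi f' g V : R -> R) (N : set R) (p q C : R) :
  absolutely_continuous a b phi -> a <= p -> p <= q -> q <= b -> mu.-negligible N ->
  (forall x y, a <= x -> x <= y -> y <= b -> `|f y - f x| <= V y - V x) ->
  (forall t, a < t < b -> ~ N t -> is_derive t 1 f (f' t)) ->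
  (forall t, a < t < b -> ~ N t -> is_derive t 1 phi (g t * f' t)) ->
  0 <= C -> (forall t, p <= t <= q -> `|g t| <= C) ->
  `|phi q - phi p| <= C * (V q - V p).
Proof.
move=> acphi ap pq qb N0 fV df dphi C0 gC.
have ndV x y : a <= x -> x <= y -> y <= b -> V x <= V y.
  by move=> ax xy yb; rewrite -subr_ge0; apply: le_trans (fV _ _ ax xy yb).
have fV' x y : a <= x <= b -> a <= y <= b -> `|f y - f x| <= `|V y - V x|.
  move=> /andP[ax xb] /andP[ay yb]; have [xy|yx] := leP x y.
    by rewrite [leRHS]ger0_norm ?subr_ge0 ?ndV// fV.
  rewrite distrC [leRHS]distrC [leRHS]ger0_norm ?subr_ge0 ?ndV// ?fV//; exact: ltW.
have N'0 := negligible_endpoints a b N0.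
apply: (ac_increment_le acphi C0 ap pq qb _ N'0).
  by move=> x y px xy yq; apply: ndV => //; [exact: le_trans px|exact: le_trans qb].
move=> t /andP[pt tq] nN't e e0.
have nNt : ~ N t by move=> h; apply: nN't; left.
have tab' : a <= t <= b by rewrite (le_trans ap pt) (le_trans tq qb).
have tab : a < t < b.
  rewrite !lt_neqAle (le_trans ap pt) (le_trans tq qb) !andbT.
  by apply/andP; split; apply/eqP => h; apply: nN't; right; [left|right].
have C1 : 0 < C + 1 by rewrite ltr_wpDl.
have e1 : 0 < e / 2 / (C + 1) by rewrite !divr_gt0.
have e2 : 0 < e / 2 by rewrite divr_gt0.
have [d1 d10 H1] := (is_derive_epsP _ _ _).1 (df t tab nNt) _ e1.
have [d2 d20 H2] := (is_derive_epsP _ _ _).1 (dphi t tab nNt) _ e2.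
exists (Num.min d1 d2); first by rewrite lt_min d10.
move=> s /andP[ps sq]; rewrite lt_min => /andP[/H1 B1 /H2 B2].
have sab : a <= s <= b by rewrite (le_trans ap ps) (le_trans sq qb).
have B3 := fV' _ _ tab' sab.
rewrite /GRing.scale/= in B1 B2.
have gt := gC t; rewrite pt tq in gt; have {}gt := gt isT.
have B4 : `|(s - t) * f' t| <= `|V s - V t| + e / 2 / (C + 1) * `|s - t|.
  have -> : (s - t) * f' t = (f s - f t) - (f s - f t - (s - t) * f' t) by ring.
  by apply: le_trans (ler_normB _ _) _; exact: lerD.
have B5 : `|g t * ((s - t) * f' t)| <= C * `|V s - V t| + e / 2 * `|s - t|.
  rewrite normrM; apply: le_trans (ler_pM _ _ gt B4) _ => //.
  rewrite mulrDr lerD2l mulrA ler_wpM2r// mulrCA -[leRHS]mulr1 ler_pM2l//.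
  by rewrite ler_pdivrMr// mul1r lerDl.
have -> : phi s - phi t = g t * ((s - t) * f' t) + (phi s - phi t - (s - t) * (g t * f' t)) by ring.
by apply: le_trans (ler_normD _ _) _; lra.
Qed.

Lemma ac_zero_derivative_const (a b : R) (phi : R -> R) (N : set R) :
  absolutely_continuous a b phi -> mu.-negligible N ->
  (forall t, a < t < b -> ~ N t -> is_derive t 1 phi 0) ->
  forall t, a <= t <= b -> phi t = phi a.
Proof.
move=> acphi N0 dphi t /andP[At tb].
have := @ac_derivative_increment_le a b (fun=> 0) phi (fun=> 0) (fun=> 0) (fun=> 0) N a t 0
  acphi (lexx _) At tb N0.
rewrite !mul0r => H; apply/eqP; rewrite -subr_eq0 -normr_le0; apply: H => //.
- by move=> *; rewrite subrr normr0.
- by move=> *; rewrite normr0.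
Qed.

(** The remainders phi1 and phi0 of f1 and f0 at t vanish at t and satisfy
    phi1' = (f2 - f2 t - k (y - y t)) y' and phi0' = phi1 y', so each is bounded
    by the bound on the previous one times the variation of y over [p, q]. *)
Lemma jet_estimate (a b : R) (y f0 f1 f2 v V : R -> R) (N : set R) (p q t k A : R) :
  absolutely_continuous a b y -> absolutely_continuous a b f0 ->
  absolutely_continuous a b f1 -> mu.-negligible N ->
  (forall x z, a <= x -> x <= z -> z <= b -> `|y z - y x| <= V z - V x) ->
  (forall s, a < s < b -> ~ N s -> [/\ is_derive s 1 y (v s),
     is_derive s 1 f1 (f2 s * v s) & is_derive s 1 f0 (f1 s * v s)]) ->
  a <= p -> q <= b -> p <= t <= q -> 0 <= A ->
  (forall s, p <= s <= q -> `|f2 s - f2 t - k * (y s - y t)| <= A) ->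
  forall s, p <= s <= q ->
  `|f1 s - f1 t - f2 t * (y s - y t) - k * (y s - y t) ^+ 2 / 2| <= A * (V q - V p) /\
  `|f0 s - f0 t - f1 t * (y s - y t) - f2 t * (y s - y t) ^+ 2 / 2 -
     k * (y s - y t) ^+ 3 / 6| <= A * (V q - V p) * (V q - V p).
Proof.
move=> acy ac0 ac1 N0 yV der ap qb /andP[pt tq] A0 H2.
have pq := le_trans pt tq; have ab := le_trans ap (le_trans pq qb).
have ndV x z : a <= x -> x <= z -> z <= b -> V x <= V z.
  by move=> ax xz zb; rewrite -subr_ge0; apply: le_trans (yV _ _ ax xz zb).
pose D s := y s - y t.
pose phi1 s := f1 s - f1 t - f2 t * D s - k / 2 * (D s * D s).
pose phi0 s := f0 s - f0 t - f1 t * D s - f2 t / 2 * (D s * D s) - k / 6 * (D s * (D s * D s)).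
have acD : absolutely_continuous a b D by apply: ac_sub => //; exact: ac_cst.
have acD2 : absolutely_continuous a b (fun s => D s * D s) by exact: ac_mul.
have acphi1 : absolutely_continuous a b phi1.
  apply: ac_sub => //; last exact: ac_scale.
  apply: ac_sub => //; last exact: ac_scale.
  by apply: ac_sub => //; exact: ac_cst.
have acphi0 : absolutely_continuous a b phi0.
  apply: ac_sub => //; last by apply: ac_scale => //; exact: ac_mul.
  apply: ac_sub => //; last exact: ac_scale.
  apply: ac_sub => //; last exact: ac_scale.
  by apply: ac_sub => //; exact: ac_cst.
have dy s : a < s < b -> ~ N s -> is_derive s 1 y (v s) by move=> h1 h2; have [] := der s h1 h2.
have dD s : a < s < b -> ~ N s -> is_derive s 1 D (v s).
  move=> h1 h2; apply: (is_derive_congr (is_derive_sub (dy _ h1 h2) (is_derive_const _ _))).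
  by rewrite subr0.
have dD2 s : a < s < b -> ~ N s -> is_derive s 1 (fun s => D s * D s) (2 * D s * v s).
  by move=> h1 h2; apply: (is_derive_congr (is_derive_mul (dD _ h1 h2) (dD _ h1 h2))); ring.
have dphi1 s : a < s < b -> ~ N s -> is_derive s 1 phi1 ((f2 s - f2 t - k * D s) * v s).
  move=> h1 h2; have [_ d1 _] := der s h1 h2.
  apply: (is_derive_congr (is_derive_sub (is_derive_sub (is_derive_sub d1 (is_derive_const _ _))
    (is_derive_scale _ (dD _ h1 h2))) (is_derive_scale _ (dD2 _ h1 h2)))).
  by field.
have dphi0 s : a < s < b -> ~ N s -> is_derive s 1 phi0 (phi1 s * v s).
  move=> h1 h2; have [_ _ d0] := der s h1 h2.
  apply: (is_derive_congr (is_derive_sub (is_derive_sub (is_derive_sub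
    (is_derive_sub d0 (is_derive_const _ _))
    (is_derive_scale _ (dD _ h1 h2))) (is_derive_scale _ (dD2 _ h1 h2)))
    (is_derive_scale _ (is_derive_mul (dD _ h1 h2) (dD2 _ h1 h2))))).
  by rewrite /phi1; field.
have phi1t : phi1 t = 0 by rewrite /phi1 /D subrr; ring.
have phi0t : phi0 t = 0 by rewrite /phi0 /D subrr; ring.
have Vpq : 0 <= V q - V p by rewrite subr_ge0 ndV.
have incr phi g C : absolutely_continuous a b phi ->
    (forall s, a < s < b -> ~ N s -> is_derive s 1 phi (g s * v s)) -> phi t = 0 -> 0 <= C ->
    (forall s, p <= s <= q -> `|g s| <= C) ->
    forall s, p <= s <= q -> `|phi s| <= C * (V q - V p).
  move=> acphi dphi phit C0 gC s /andP[ps sq].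
  have at' : a <= t := le_trans ap pt; have as' := le_trans ap ps.
  have tb := le_trans tq qb; have sb := le_trans sq qb.
  have [ts|st] := leP t s.
    have := ac_derivative_increment_le acphi at' ts sb N0 yV dy dphi C0.
    rewrite phit subr0 => H; apply: le_trans (H _) _.
      by move=> r /andP[tr rs]; apply: gC; rewrite (le_trans pt tr) (le_trans rs sq).
    by rewrite ler_wpM2l// lerB// ndV.
  have := ac_derivative_increment_le acphi as' (ltW st) tb N0 yV dy dphi C0.
  rewrite phit sub0r normrN => H; apply: le_trans (H _) _.
    by move=> r /andP[sr rt]; apply: gC; rewrite (le_trans ps sr) (le_trans rt tq).
  by rewrite ler_wpM2l// lerB// ndV.
have P1 := incr phi1 _ A acphi1 dphi1 phi1t A0 H2.
have P0 := incr phi0 _ _ acphi0 dphi0 phi0t (mulr_ge0 A0 Vpq) P1.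
move=> s ps; split.
  by move: (P1 s ps); congr (`|_| <= _); rewrite /phi1 /D; field.
by move: (P0 s ps); congr (`|_| <= _); rewrite /phi0 /D; field.
Qed.

End jets.

(** * Curves in the Engel group *)

Section along_curve.
Variable R : realType.
Local Notation mu := (@lebesgue_measure R).

(** A step of fixed length h can be taken inside [a, b] from every point of K,
    to the left or to the right, and f' t is within 1 of the corresponding
    difference quotient. *)
Lemma uniform_derivative_bounded (a b : R) (f f' : R -> R) (K : set R) : a < b ->
  (exists M, forall t, a <= t <= b -> `|f t| <= M) ->
  K `<=` `[a, b]%classic ->
  (exists2 r, 0 < r & forall t, K t -> forall s, a <= s <= b -> `|s - t| < r ->
    `|f s - f t - f' t * (s - t)| <= `|s - t|) ->
  exists L, forall t, K t -> `|f' t| <= L.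
Proof.
move=> ab [M fM] Kab [r r0 Hr].
pose h := Num.min (r / 2) ((b - a) / 2).
have h0 : 0 < h by rewrite lt_min !divr_gt0 ?subr_gt0.
have hr : h < r by rewrite gt_min; apply/orP; left; lra.
have hab : h <= (b - a) / 2 by rewrite ge_min lexx orbT.
exists ((M + M) / h + 1) => t Kt.
have := Kab _ Kt; rewrite /= in_itv/= => tab.
have [s [sab st]] : exists s, a <= s <= b /\ `|s - t| = h.
  have /andP[At tb] := tab.
  have [tm|mt] := leP t ((a + b) / 2).
    exists (t + h); rewrite addrAC subrr add0r gtr0_norm//; split => //.
    by apply/andP; split; lra.
  exists (t - h); rewrite addrAC subrr add0r normrN gtr0_norm//; split => //.
  by apply/andP; split; lra.
have := Hr t Kt s sab; rewrite st => /(_ hr) B.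
have B1 : `|f' t * (s - t)| <= `|f s| + `|f t| + h.
  have -> : f' t * (s - t) = f s - f t - (f s - f t - f' t * (s - t)) by ring.
  by apply: le_trans (ler_normB _ _) _; apply: lerD => //; exact: ler_normB.
have := fM s sab; have := fM t tab => B2 B3.
rewrite -(ler_pM2r h0) mulrDl divfK ?gt_eqF// mul1r.
by rewrite normrM st in B1; lra.
Qed.

Lemma compact_norm_bounded (K : set R) : compact K -> exists M, forall x, K x -> `|x| <= M.
Proof.
move=> /compact_bounded[M [_ HM]]; exists (M + 1) => x Kx.
by apply: (HM (M + 1)) => //; rewrite ltrDl.
Qed.

(** Reads the Taylor conditions through the inverse of y on y(K): since y
    expands distances, remainders that are small in |s - t| are small in
    |y s - y t|. *)
Lemma C3_extension_along (K : set R) (y f0 f1 f2 f3 : R -> R) (c : R) : compact K ->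
  {within K, continuous y} -> 0 < c ->
  (forall s t, K s -> K t -> c * `|s - t| <= `|y s - y t|) ->
  (forall e : R, 0 < e -> exists2 d, 0 < d & forall t s, K t -> K s -> `|s - t| < d ->
    [/\ `|f0 s - f0 t - f1 t * (y s - y t) - f2 t * (y s - y t) ^+ 2 / 2 -
          f3 t * (y s - y t) ^+ 3 / 6| <= e * `|s - t| ^+ 3,
        `|f1 s - f1 t - f2 t * (y s - y t) - f3 t * (y s - y t) ^+ 2 / 2| <= e * `|s - t| ^+ 2 &
        `|f2 s - f2 t - f3 t * (y s - y t)| <= e * `|s - t|]) ->
  exists h0 h1 h2 h3 : R -> R,
    [/\ [/\ forall s : R, is_derive s 1 h0 (h1 s),
            forall s : R, is_derive s 1 h1 (h2 s),
            forall s : R, is_derive s 1 h2 (h3 s) & continuous h3] &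
        forall t, K t -> [/\ h0 (y t) = f0 t, h1 (y t) = f1 t & h2 (y t) = f2 t]].
Proof.
move=> cK cy c0 inj H.
pose E := y @` K.
have cE : compact E by exact: continuous_compact.
have [T HT] : {T : R -> R & forall x, E x -> K (T x) /\ y (T x) = x}.
  apply: (@boolp.choice _ _ (fun x t => E x -> K t /\ y t = x)) => x.
  have [[t Kt <-]|nE] := pselect (E x); first by exists t.
  by exists 0 => /nE.
have Ty t : K t -> T (y t) = t.
  move=> Kt; have [KT yT] := HT (y t) (ex_intro2 _ _ t Kt erefl).
  apply/eqP; rewrite -subr_eq0 -normr_le0 -(ler_pM2l c0) mulr0.
  by apply: le_trans (inj _ _ KT Kt) _; rewrite yT subrr normr0.
have [|||h0 [h1 [h2 [h3 [h hE]]]]] :=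
    @C3_extension R E (f0 \o T) (f1 \o T) (f2 \o T) (f3 \o T).
- by apply: compact_closed => //; exact: Rhausdorff.
- exact: compact_norm_bounded.
- move=> e e0; pose m := Num.min (Num.min c (c ^+ 2)) (c ^+ 3).
  have m0 : 0 < m by rewrite !lt_min c0 !exprn_gt0.
  have [d d0 Hd] := H _ (mulr_gt0 e0 m0).
  exists (d * c); first exact: mulr_gt0.
  move=> x z Ex Ez zx; have [KTx yTx] := HT _ Ex; have [KTz yTz] := HT _ Ez.
  have lip := inj _ _ KTz KTx; rewrite yTx yTz in lip.
  have [|B0 B1 B2] := Hd (T x) (T z) KTx KTz.
    by rewrite -(ltr_pM2l c0) (le_lt_trans lip)// mulrC.
  rewrite yTx yTz in B0 B1 B2.
  have scale n : m <= c ^+ n -> e * m * `|T z - T x| ^+ n <= e * `|z - x| ^+ n.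
    move=> mn; rewrite -mulrA ler_wpM2l ?(ltW e0)//.
    apply: (@le_trans _ _ (c ^+ n * `|T z - T x| ^+ n)).
      by rewrite ler_wpM2r// exprn_ge0.
    by rewrite -exprMn lerXn2r// nnegrE mulr_ge0// ltW.
  split => /=.
  + by apply: le_trans B0 _; apply: scale; rewrite /m ge_min lexx orbT.
  + by apply: le_trans B1 _; apply: scale; rewrite /m !ge_min lexx !orbT.
  + apply: le_trans B2 _; rewrite -[X in _ <= _ * X]expr1 -[X in _ * X <= _]expr1.
    by apply: scale; rewrite expr1 /m !ge_min lexx.
exists h0, h1, h2, h3; split => // t Kt.
have Ey : E (y t) by exists t.
by have /= [-> -> ->] := hE _ Ey; rewrite Ty.
Qed.
End along_curve.

Section horizontal_curves.
Variable R : realType.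
Local Notation mu := (@lebesgue_measure R).
Let o1 : 'I_4 := @Ordinal 4 1 isT.
Let o2 : 'I_4 := @Ordinal 4 2 isT.
Let o3 : 'I_4 := @Ordinal 4 3 isT.

Lemma ord4P (P : 'I_4 -> Prop) : P ord0 -> P o1 -> P o2 -> P o3 -> forall i, P i.
Proof.
move=> P0 P1 P2 P3 [[|[|[|[|i]]]] Hi]; last by [].
- by rewrite (_ : Ordinal Hi = ord0)//; exact: val_inj.
- by rewrite (_ : Ordinal Hi = o1)//; exact: val_inj.
- by rewrite (_ : Ordinal Hi = o2)//; exact: val_inj.
- by rewrite (_ : Ordinal Hi = o3)//; exact: val_inj.
Qed.

Lemma row_norm_leP n (v : 'rV[R]_n) (e : R) : 0 <= e ->
  (`|v| <= e) <-> (forall i, `|v 0 i| <= e).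
Proof.
move=> e0; rewrite [`|v|]mx_normrE; split=> [H i|H].
  by apply: le_trans H; exact: (le_bigmax _ (fun ij => `|v ij.1 ij.2|) (0, i)).
by apply: bigmax_le => // -[j i] _ /=; rewrite (ord1 j).
Qed.

Lemma row_is_deriveP n (g : R -> 'rV[R]_n) (t : R) (v : 'rV[R]_n) :
  is_derive t 1 g v <-> forall i, is_derive t 1 (fun s => g s 0 i) (v 0 i).
Proof.
split=> [/is_derive_epsP H i|H].
  apply/is_derive_epsP => e e0; have [d d0 Hd] := H e e0; exists d => // s /Hd.
  have e1 : 0 <= e * `|s - t| by rewrite mulr_ge0// ltW.
  by move=> /(row_norm_leP _ e1)/(_ i); rewrite !mxE.
apply/is_derive_epsP => e e0.
have /boolp.choice[d Hd] i : exists d, 0 < d /\ forall s, `|s - t| < d ->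
    `|g s 0 i - g t 0 i - (s - t) *: v 0 i| <= e * `|s - t|.
  by have [d d0 Hd] := (is_derive_epsP _ _ _).1 (H i) e e0; exists d.
exists (\big[Num.min/1]_i d i).
  by apply/lt_bigmin => // i _; have [] := Hd i.
move=> s sd; have e1 : 0 <= e * `|s - t| by rewrite mulr_ge0// ltW.
apply/(row_norm_leP _ e1) => i; rewrite !mxE; have [_] := Hd i; apply.
by apply: lt_le_trans sd _; exact: bigmin_le.
Qed.

Lemma row_continuous n (g : R -> 'rV[R]_n) :
  (forall i, continuous (fun s => g s 0 i)) -> continuous g.
Proof.
move=> H t; apply/continuous_at_epsP => e e0.
have /boolp.choice[d Hd] i : exists d, 0 < d /\ forall s, `|s - t| < d ->
    `|g s 0 i - g t 0 i| <= e.
  by have [d d0 Hd] := (continuous_at_epsP _ _).1 (H i t) e e0; exists d.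
exists (\big[Num.min/1]_i d i).
  by apply/lt_bigmin => // i _; have [] := Hd i.
move=> s sd; apply/(row_norm_leP _ (ltW e0)) => i; rewrite !mxE; have [_] := Hd i; apply.
by apply: lt_le_trans sd _; exact: bigmin_le.
Qed.

Lemma ac_coord n (a b : R) (g : R -> 'rV[R]_n) i : absolutely_continuous a b g ->
  absolutely_continuous a b (fun t => g t 0 i).
Proof.
move=> acg; apply: (@ac_dominated _ _ _ _ _ _ g g _ 1) => // s t _ _.
rewrite mul1r; apply: (@le_trans _ _ `|g s - g t|); last by rewrite lerDl.
by have /(row_norm_leP _ (normr_ge0 _))/(_ i) := lexx `|g s - g t|; rewrite !mxE.
Qed.

Lemma horizontal_coordinates (a b : R) (g : R -> 'rV[R]_4) : engel_horizontal a b g ->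
  exists (N : set R) (u1 u2 : R -> R), mu.-negligible N /\
    forall t, a < t < b -> ~ N t ->
    [/\ is_derive t 1 (fun s => g s 0 ord0) (u1 t),
        is_derive t 1 (fun s => g s 0 o1) (u2 t),
        is_derive t 1 (fun s => g s 0 o2) (g t 0 ord0 * u2 t) &
        is_derive t 1 (fun s => g s 0 o3) (2^-1 * g t 0 ord0 ^+ 2 * u2 t)].
Proof.
move=> [_ [A [mA A0 HA]]].
have /boolp.choice[u Hu] t : exists u : R * R, a < t < b -> ~ A t ->
    is_derive t 1 g (u.1 *: engel_X1 (g t) + u.2 *: engel_X2 (g t)).
  have [[tab nAt]|h] := pselect (a < t < b /\ ~ A t); last by exists (0, 0) => h1 h2; case: h.
  have : exists u1 u2 : R, is_derive t 1 g (u1 *: engel_X1 (g t) + u2 *: engel_X2 (g t)).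
    apply: contrapT => nu; apply: nAt; apply: HA => /= h; apply: nu; apply: h.
    by rewrite in_itv.
  by move=> [u1 [u2 h]]; exists (u1, u2).
exists A, (fun t => (u t).1), (fun t => (u t).2); split.
  by exists A; split.
move=> t tab nAt; have /row_is_deriveP H := Hu t tab nAt.
by split; [move: (H ord0)|move: (H o1)|move: (H o2)|move: (H o3)];
  rewrite !mxE/= => h; apply: (is_derive_congr h); ring.
Qed.

Lemma bounded_derivative_lipschitz (f f' : R -> R) (a b M s t : R) :
  (forall r : R, is_derive r 1 f (f' r)) -> (forall r, a <= r <= b -> `|f' r| <= M) ->
  a <= s <= b -> a <= t <= b -> `|f s - f t| <= M * `|s - t|.
Proof.
move=> df fM; wlog st : s t / t <= s.
  move=> H sab tab; have [ts|/ltW st] := leP t s; first exact: H.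
  by rewrite distrC (distrC s); exact: H.
move=> /andP[As sb] /andP[At tb].
have [|c] := @MVT_segment R f f' t s st.
  by apply: derivable_within_continuous => r _; have [] := df r.
rewrite in_itv/= => /andP[tc cs] ->; rewrite normrM ler_wpM2r// fM//.
by rewrite (le_trans At tc) (le_trans cs sb).
Qed.

(** Only the C^1 regularity of X1 and X2 is prescribed: the equations for X3 and
    X4 then make the whole velocity continuous. *)
Lemma engel_C1_horizontal_lift (a b : R) (X1 X2 X3 X4 v1 v2 : R -> R) : a <= b ->
  continuous v1 -> continuous v2 ->
  (forall t : R, is_derive t 1 X1 (v1 t)) ->
  (forall t : R, is_derive t 1 X2 (v2 t)) ->
  (forall t : R, is_derive t 1 X3 (X1 t * v2 t)) ->
  (forall t : R, is_derive t 1 X4 (2^-1 * X1 t ^+ 2 * v2 t)) ->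
  engel_C1_horizontal a b (fun t => \row_(i < 4) [:: X1 t; X2 t; X3 t; X4 t]`_i).
Proof.
move=> ab cv1 cv2 d1 d2 d3 d4.
set G := (fun t => \row_(i < 4) _).
pose v t : 'rV[R]_4 := v1 t *: engel_X1 (G t) + v2 t *: engel_X2 (G t).
have dG (t : R) : is_derive t 1 G (v t).
  apply/row_is_deriveP; apply: ord4P.
  - have -> : (fun s => G s 0 ord0) = X1 by apply/funext => s; rewrite !mxE.
    by apply: (is_derive_congr (d1 t)); rewrite !mxE/=; ring.
  - have -> : (fun s => G s 0 o1) = X2 by apply/funext => s; rewrite !mxE.
    by apply: (is_derive_congr (d2 t)); rewrite !mxE/=; ring.
  - have -> : (fun s => G s 0 o2) = X3 by apply/funext => s; rewrite !mxE.
    by apply: (is_derive_congr (d3 t)); rewrite !mxE/=; ring.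
  - have -> : (fun s => G s 0 o3) = X4 by apply/funext => s; rewrite !mxE.
    by apply: (is_derive_congr (d4 t)); rewrite !mxE/=; ring.
have cX1 : continuous X1 by move=> t; exact: is_derive_continuous (d1 t).
have cv : continuous v.
  apply: row_continuous; apply: ord4P.
  - by have -> : (fun s => v s 0 ord0) = v1 by apply/funext => s; rewrite !mxE/=; ring.
  - by have -> : (fun s => v s 0 o1) = v2 by apply/funext => s; rewrite !mxE/=; ring.
  - have -> : (fun s => v s 0 o2) = (fun s => X1 s * v2 s).
      by apply/funext => s; rewrite !mxE/=; ring.
    by move=> t; apply: cvgM; [exact: cX1|exact: cv2].
  - have -> : (fun s => v s 0 o3) = (fun s => 2^-1 * (X1 s * X1 s) * v2 s).
      by apply/funext => s; rewrite !mxE/=; ring.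
    move=> t; apply: cvgM; last exact: cv2.
    by apply: cvgM; [exact: cvg_cst|apply: cvgM; exact: cX1].
have [M [M0 vM]] : exists M, 0 <= M /\ forall t, a <= t <= b -> `|v t| <= M.
  have [|c _ Hc] := @EVT_max R (fun t => `|v t|) a b ab.
    by apply: continuous_subspaceT => t; apply: cvg_norm; exact: cv.
  by exists `|v c|; split => // t tab; apply: Hc; rewrite in_itv.
split; last first.
  exists v; last exact: continuous_subspaceT.
  move=> t _; apply/cvgrPdist_le => e e0.
  have [d d0 Hd] := (is_derive_epsP _ _ _).1 (dG t) e e0.
  exists d => //= s; rewrite /ball/= distrC => st s0 _.
  have st0 : 0 < `|s - t| by rewrite normr_gt0 subr_eq0.
  rewrite -(ler_pM2l st0) -normrZ scalerBr scalerA divff ?subr_eq0// scale1r distrC mulrC.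
  exact: Hd.
split; last first.
  by apply: aeW => t _; exists (v1 t), (v2 t); exact: dG.
apply: (@ac_dominated _ _ _ _ _ _ (fun t => t) (fun t => t) _ (M + 1)); rewrite ?ltr_wpDl//.
- exact: ac_id.
- exact: ac_id.
move=> s t sab tab.
apply: (@le_trans _ _ (M * `|s - t|)); last by rewrite ler_pM// lerDl.
apply/(row_norm_leP _ _); first exact: mulr_ge0.
move=> i; have := @bounded_derivative_lipschitz (fun r => G r 0 i) (fun r => v r 0 i) a b M s t.
rewrite !mxE; apply => //.
  by move=> r; move: i; apply/row_is_deriveP.
by move=> r /vM; move/(row_norm_leP _ M0).
Qed.

End horizontal_curves.

Section engel_lusin.
Variable R : realType.
Local Notation mu := (@lebesgue_measure R).
Let o1 : 'I_4 := @Ordinal 4 1 isT.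
Let o2 : 'I_4 := @Ordinal 4 2 isT.
Let o3 : 'I_4 := @Ordinal 4 3 isT.

Lemma engel_lift_matching (a b : R) (gamma : R -> 'rV[R]_4) (K : set R)
    (X1 X2 X3 X4 v1 v2 : R -> R) : a <= b ->
  continuous v1 -> continuous v2 ->
  (forall t : R, is_derive t 1 X1 (v1 t)) ->
  (forall t : R, is_derive t 1 X2 (v2 t)) ->
  (forall t : R, is_derive t 1 X3 (X1 t * v2 t)) ->
  (forall t : R, is_derive t 1 X4 (2^-1 * X1 t ^+ 2 * v2 t)) ->
  K `<=` `[a, b]%classic -> (0 < mu K)%E ->
  (forall t, K t -> [/\ X1 t = gamma t 0 ord0, X2 t = gamma t 0 o1,
     X3 t = gamma t 0 o2 & X4 t = gamma t 0 o3]) ->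
  exists Gamma : R -> 'rV[R]_4, engel_C1_horizontal a b Gamma /\
    (0 < mu [set t : R | t \in `[a, b] /\ Gamma t = gamma t])%E.
Proof.
move=> ab cv1 cv2 d1 d2 d3 d4 Kab K0 KX.
exists (fun t => \row_(i < 4) [:: X1 t; X2 t; X3 t; X4 t]`_i); split.
  exact: (engel_C1_horizontal_lift ab cv1 cv2 d1 d2 d3 d4).
apply: lt_le_trans K0 _; apply: le_outer_measure => t Kt; split; first exact: Kab.
have [e1 e2 e3 e4] := KX t Kt.
by apply/rowP; apply: ord4P; rewrite mxE.
Qed.

Lemma compact_C1_extension (a b : R) (x x' : R -> R) (N U K : set R) : compact K ->
  K `<=` `[a, b]%classic ->
  (forall t, K t -> ~ U t /\ ~ (N `|` [set a; b]) t) ->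
  (forall eta, 0 < eta -> exists2 r, 0 < r & forall t, a < t < b -> ~ N t -> ~ U t ->
    forall s, a <= s <= b -> `|s - t| < r ->
    `|x s - x t - x' t * (s - t)| <= eta * `|s - t|) ->
  exists g g' : R -> R,
    [/\ forall s : R, is_derive s 1 g (g' s), continuous g' &
        forall t, K t -> g t = x t].
Proof.
move=> cK Kab KU H; apply: (@C1_extension R K x x').
- by apply: compact_closed => //; exact: Rhausdorff.
- exact: compact_norm_bounded.
move=> e e0; have [r r0 Hr] := H e e0; exists r => // t s Kt Ks st.
have [nU /not_orP[nN /not_orP[ta tb]]] := KU t Kt.
have := Kab _ Kt; rewrite /= in_itv/= => /andP[At Bt].
have := Kab _ Ks; rewrite /= in_itv/= => sab.
apply: Hr => //; rewrite !lt_neqAle At Bt !andbT.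
by apply/andP; split; apply/eqP => h; [exact: ta|exact: tb].
Qed.

Lemma engel_lusin_constant (a b : R) (gamma : R -> 'rV[R]_4) (N : set R) (u1 u2 : R -> R) :
  a < b -> absolutely_continuous a b gamma -> mu.-negligible N ->
  (forall t, a < t < b -> ~ N t ->
    [/\ is_derive t 1 (fun s => gamma s 0 ord0) (u1 t),
        is_derive t 1 (fun s => gamma s 0 o1) (u2 t),
        is_derive t 1 (fun s => gamma s 0 o2) (gamma t 0 ord0 * u2 t) &
        is_derive t 1 (fun s => gamma s 0 o3) (2^-1 * gamma t 0 ord0 ^+ 2 * u2 t)]) ->
  mu.-negligible [set t | [/\ a < t < b, ~ N t & u1 t != 0]] ->
  exists Gamma : R -> 'rV[R]_4, engel_C1_horizontal a b Gamma /\
    (0 < mu [set t : R | t \in `[a, b] /\ Gamma t = gamma t])%E.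
Proof.
move=> hab acg N0 H Z0; have ab := ltW hab.
have ac i : absolutely_continuous a b (fun t => gamma t 0 i) by exact: ac_coord.
pose N' := N `|` [set t | [/\ a < t < b, ~ N t & u1 t != 0]].
have N'0 : mu.-negligible N' by exact: negligibleU.
have u10 t : a < t < b -> ~ N' t -> u1 t = 0.
  move=> tab nN'; apply: contrapT => /eqP u; apply: (nN'); right; split => // Nt.
  by apply: (nN'); left.
have nN t : ~ N' t -> ~ N t by move=> h Nt; apply: h; left.
pose c := gamma a 0 ord0.
have x1c t : a <= t <= b -> gamma t 0 ord0 = c.
  apply: (ac_zero_derivative_const (ac ord0) N'0) => s sab nN's.
  by have [h _ _ _] := H s sab (nN _ nN's); rewrite -(u10 s).
pose c3 := gamma a 0 o2 - c * gamma a 0 o1.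
pose c4 := gamma a 0 o3 - 2^-1 * c ^+ 2 * gamma a 0 o1.
have x3c t : a <= t <= b -> gamma t 0 o2 - c * gamma t 0 o1 = c3.
  apply: (@ac_zero_derivative_const _ a b (fun t => gamma t 0 o2 - c * gamma t 0 o1) N') => //.
    by apply: ac_sub => //; exact: ac_scale.
  move=> s sab nN's; have [_ h2 h3 _] := H s sab (nN _ nN's).
  apply: (is_derive_congr (is_derive_sub h3 (is_derive_scale c h2))).
  by rewrite x1c ?subrr//; move/andP: sab => [? ?]; rewrite !ltW.
have x4c t : a <= t <= b -> gamma t 0 o3 - 2^-1 * c ^+ 2 * gamma t 0 o1 = c4.
  apply: (@ac_zero_derivative_const _ a b
    (fun t => gamma t 0 o3 - 2^-1 * c ^+ 2 * gamma t 0 o1) N') => //.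
    by apply: ac_sub => //; exact: ac_scale.
  move=> s sab nN's; have [_ h2 _ h4] := H s sab (nN _ nN's).
  apply: (is_derive_congr (is_derive_sub h4 (is_derive_scale (2^-1 * c ^+ 2) h2))).
  by rewrite x1c ?subrr//; move/andP: sab => [? ?]; rewrite !ltW.
have e0 : 0 < (b - a) / 2 by rewrite divr_gt0// subr_gt0.
have [U [mU Ue HU]] := uniform_derivative_off_small ab (ac_small (ac o1)) N0
  (fun t tab nNt => let: And4 _ h _ _ := H t tab nNt in h) e0.
have [||K [cK Kab KU K0]] := @compact_subset_off R `[a, b]%classic U (N `|` [set a; b])
  (measurable_itv _) mU.
- apply: le_lt_trans Ue _; rewrite lebesgue_measure_itv/= lte_fin hab -EFinB lte_fin; lra.
- exact: negligible_endpoints.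
have [g [g' [dg cg gK]]] := compact_C1_extension cK Kab KU HU.
apply: (@engel_lift_matching a b gamma K (fun=> c) g (fun t => c * g t + c3)
  (fun t => 2^-1 * c ^+ 2 * g t + c4) (fun=> 0) g') => //.
- by move=> t; exact: cvg_cst.
- move=> t; apply: (is_derive_congr
    (is_derive_add (is_derive_scale c (dg t)) (is_derive_const _ _))).
  by rewrite addr0.
- move=> t; apply: (is_derive_congr
    (is_derive_add (is_derive_scale _ (dg t)) (is_derive_const _ _))).
  by rewrite addr0.
move=> t Kt; have := Kab _ Kt; rewrite /= in_itv/= => tab.
by rewrite gK// x1c// -(x3c t)// -(x4c t)//; split => //; ring.
Qed.

(** K is a compact part of C on which x1 and x2 are uniformly differentiable and
    the variation of x1 grows at most linearly to the right.  The right-hand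
    bound is enough: for two points of K it is applied at the left one,
    whichever of them carries the Taylor expansion. *)
Lemma engel_lusin_transverse (a b : R) (gamma : R -> 'rV[R]_4) (N C : set R)
    (u1 u2 : R -> R) (c : R) :
  a < b -> absolutely_continuous a b gamma -> mu.-negligible N ->
  (forall t, a < t < b -> ~ N t ->
    [/\ is_derive t 1 (fun s => gamma s 0 ord0) (u1 t),
        is_derive t 1 (fun s => gamma s 0 o1) (u2 t),
        is_derive t 1 (fun s => gamma s 0 o2) (gamma t 0 ord0 * u2 t) &
        is_derive t 1 (fun s => gamma s 0 o3) (2^-1 * gamma t 0 ord0 ^+ 2 * u2 t)]) ->
  closed C -> C `<=` `[a, b]%classic -> (0 < mu C)%E -> 0 < c ->
  (forall s t, C s -> C t -> c * `|s - t| <= `|gamma s 0 ord0 - gamma t 0 ord0|) ->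
  exists Gamma : R -> 'rV[R]_4, engel_C1_horizontal a b Gamma /\
    (0 < mu [set t : R | t \in `[a, b] /\ Gamma t = gamma t])%E.
Proof.
move=> hab acg N0 H cC Cab C0 c0 Cinj; have ab := ltW hab.
have ac i : absolutely_continuous a b (fun t => gamma t 0 i) by exact: ac_coord.
pose x1 t := gamma t 0 ord0; pose x2 t := gamma t 0 o1.
pose x3 t := gamma t 0 o2; pose x4 t := gamma t 0 o3.
have ac1 : absolutely_continuous a b x1 by exact: ac.
have ac2 : absolutely_continuous a b x2 by exact: ac.
have [V [x1V cV]] := ac_variation_function ab ac1.
have ndV x y : a <= x -> x <= y -> y <= b -> V x <= V y.
  by move=> ax xy yb; rewrite -subr_ge0; apply: le_trans (x1V _ _ ax xy yb).
have Cfin : mu C \is a fin_num.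
  rewrite ge0_fin_numE ?measure_ge0//.
  apply: (@le_lt_trans _ _ (mu `[a, b]%classic)); first exact: le_outer_measure.
  by rewrite lebesgue_measure_itv/= lte_fin hab ltry.
pose e := fine (mu C) / 4.
(* Three exceptional sets of measure at most e are removed from C. *)
have e0 : 0 < e by rewrite divr_gt0// fine_gt0// C0 ltey_eq Cfin.
have [U1 [mU1 U1e HU1]] := uniform_derivative_off_small ab (ac_small ac1) N0
  (fun t tab nNt => let: And4 h _ _ _ := H t tab nNt in h) e0.
have [U2 [mU2 U2e HU2]] := uniform_derivative_off_small ab (ac_small ac2) N0
  (fun t tab nNt => let: And4 _ h _ _ := H t tab nNt in h) e0.
have [M [U3 [M0 mU3 U3e HU3]]] := right_lipschitz_off_small ab ndV cV e0.
have mU : measurable (U1 `|` U2 `|` U3) by apply: measurableU => //; exact: measurableU.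
have [||K [cK KC KU K0]] := @compact_subset_off R C _ (N `|` [set a; b])
  (closed_measurable cC) mU.
- apply: (@le_lt_trans _ _ ((e + e) + e)%:E); last first.
    rewrite -[mu C]fineK// lte_fin /e; have : 0 < fine (mu C) by rewrite fine_gt0// C0 ltey_eq Cfin.
    lra.
  apply: le_trans (outer_measureU2 _ _ _) _; rewrite EFinD leeD//.
  by apply: le_trans (outer_measureU2 _ _ _) _; rewrite EFinD leeD.
- exact: negligible_endpoints.
have Kab := subset_trans KC Cab.
have Kin t : K t -> [/\ a < t < b, ~ N t, ~ U1 t, ~ U2 t & ~ U3 t].
  move=> Kt; have [/not_orP[/not_orP[n1 n2] n3] /not_orP[nN /not_orP[ta tb]]] := KU t Kt.
  have := Kab _ Kt; rewrite /= in_itv/= => /andP[At Bt]; split => //.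
  rewrite !lt_neqAle At Bt !andbT.
  by apply/andP; split; apply/eqP => h; [exact: ta|exact: tb].
have KU1 t : K t -> ~ U1 t /\ ~ (N `|` [set a; b]) t.
  by move=> Kt; have [_ h] := KU t Kt; have [_ _ h1 _ _] := Kin t Kt.
have KU2 t : K t -> ~ U2 t /\ ~ (N `|` [set a; b]) t.
  by move=> Kt; have [_ h] := KU t Kt; have [_ _ _ h1 _] := Kin t Kt.
have inj s t : K s -> K t -> c * `|s - t| <= `|x1 s - x1 t|.
  by move=> Ks Kt; apply: Cinj; exact: KC.
have [X1 [v1 [dX1 cv1 X1K]]] := compact_C1_extension cK Kab KU1 HU1.
have [L Lu2] : exists L, forall t, K t -> `|u2 t| <= L.
  apply: (@uniform_derivative_bounded R a b x2 u2 K hab) => //.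
    by have [B [_ HB]] := ac_bounded ab ac2; exists B.
  have [r r0 Hr] := HU2 1 ltr01; exists r => // t Kt s sab st.
  by have [tab nN _ n2 _] := Kin t Kt; have := Hr t tab nN n2 s sab st; rewrite mul1r.
pose f1 t := x1 t * x2 t - x3 t.
pose f0 t := 2^-1 * (x1 t * x1 t * x2 t) - x1 t * x3 t + x4 t.
pose k t := u2 t / u1 t.
have acf1 : absolutely_continuous a b f1.
  by apply: ac_sub => //; [exact: ac_mul|exact: ac].
have acf0 : absolutely_continuous a b f0.
  apply: ac_add; last exact: ac.
  apply: ac_sub => //; first by apply: ac_scale => //; apply: ac_mul => //; exact: ac_mul.
  by apply: ac_mul => //; exact: ac.
have der s : a < s < b -> ~ N s -> [/\ is_derive s 1 x1 (u1 s),
    is_derive s 1 f1 (x2 s * u1 s) & is_derive s 1 f0 (f1 s * u1 s)].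
  move=> sab nNs; have [h1 h2 h3 h4] := H s sab nNs; split => //.
    apply: (is_derive_congr (is_derive_sub (is_derive_mul h1 h2) h3)).
    by rewrite -/(x1 s) -/(x2 s); ring.
  apply: (is_derive_congr (is_derive_add (is_derive_sub (is_derive_scale 2^-1
    (is_derive_mul (is_derive_mul h1 h1) h2)) (is_derive_mul h1 h3)) h4)).
  by rewrite /f1 -/(x1 s) -/(x2 s) -/(x3 s); field.
have cx1 : {within K, continuous x1}.
  apply: (continuous_subspaceW Kab).
  have clampE : {in `[a, b]%classic, (fun t => x1 (Num.max a (Num.min b t))) =1 x1}.
    by move=> t; rewrite inE/= in_itv/= => /andP[At tb]; rewrite (min_idPr tb) (max_idPr At).
  apply: (subspace_eq_continuous clampE); apply: continuous_subspaceT.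
  exact: (continuous_clamp (ac_small ac1) ab).
have [|h0 [h1 [h2 [h3 [[dh0 dh1 dh2 ch3] hK]]]]] :=
    @C3_extension_along R K x1 f0 f1 x2 k c cK cx1 c0 inj.
  move=> eps eps0; pose kap := `|L| / (c / 2).
  have kap0 : 0 <= kap by rewrite divr_ge0// divr_ge0// ltW.
  have S0 : 0 < 1 + M + M ^+ 2 by rewrite !addr_gt0// exprn_gt0.
  have kap1 : 0 < 1 + kap by rewrite ltr_wpDr.
  (* e1, e1 M and e1 M^2 are all at most eps: one factor M for each integration
     along x1. *)
  pose e1 := eps / (1 + M + M ^+ 2); have e10 : 0 < e1 by rewrite divr_gt0.
  have eta0 : 0 < e1 / (1 + kap) by rewrite divr_gt0.
  have c20 : 0 < c / 2 by rewrite divr_gt0.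
  have [r1 r10 Hr1] := HU1 _ eta0; have [r2 r20 Hr2] := HU2 _ eta0.
  have [r3 r30 Hr3] := HU1 _ c20.
  exists (Num.min (Num.min r1 r2) r3); first by rewrite !lt_min r10 r20 r30.
  move=> t s Kt Ks; rewrite !lt_min => /andP[/andP[st1 st2] st3].
  have [->|st] := eqVneq s t.
    rewrite !subrr normr0 !expr0n/= !mulr0 !mul0r !subr0 normr0.
    by split.
  have [tab nN n1 n2 n3] := Kin t Kt; have [sab _ _ _ ns3] := Kin s Ks.
  have sab' : a <= s <= b by move/andP: sab => [? ?]; rewrite !ltW.
  have d0 : 0 < `|s - t| by rewrite normr_gt0 subr_eq0.
  (* u1 may vanish at an isolated point of K, but not at a point of K that has
     another point of K this close, because x1 is expanding on K. *)
  have u1t : c / 2 <= `|u1 t|.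
    rewrite -(ler_pM2r d0) -normrM.
    have B1 := inj s t Ks Kt; have B2 := Hr3 t tab nN n1 s sab' st3.
    have : `|x1 s - x1 t| <= `|u1 t * (s - t)| + `|x1 s - x1 t - u1 t * (s - t)|.
      apply: le_trans (ler_normD _ _).
      by rewrite le_eqVlt; apply/orP; left; apply/eqP; congr `|_|; ring.
    lra.
  have u1t0 : u1 t != 0 by rewrite -normr_gt0; exact: lt_le_trans u1t.
  have kt : `|k t| <= kap.
    rewrite /k normrM normfV ler_pM ?invr_ge0//; last by rewrite lef_pV2// posrE normr_gt0.
    exact: le_trans (Lu2 t Kt) (ler_norm _).
  pose A := e1 * `|s - t|.
  have A0 : 0 <= A by rewrite mulr_ge0// ltW.
  have [p [q [[ap pt tq qb] [ps sq] Vqp pqst]]] : exists p q,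
      [/\ [/\ a <= p, p <= t, t <= q & q <= b], p <= s /\ s <= q,
          V q - V p <= M * `|s - t| & q - p = `|s - t|].
    move/andP: tab => [At tb]; move/andP: sab => [As sb].
    have [ts|ts] := leP t s.
      exists t, s; rewrite ger0_norm ?subr_ge0//; split => //; first by split => //; exact: ltW.
      by apply: HU3 => //; exact: ltW.
    exists s, t; rewrite distrC gtr0_norm ?subr_gt0//; split => //.
    - by split => //; exact: ltW.
    - by split => //; exact: ltW.
    - by apply: HU3 => //; exact: ltW.
  have pq : p <= q := le_trans pt tq.
  have H2 r : p <= r <= q -> `|x2 r - x2 t - k t * (x1 r - x1 t)| <= A.
    move=> /andP[pr rq].
    have rt : `|r - t| <= `|s - t|.
      by rewrite -pqst ler_norml opprB; apply/andP; split; apply: lerB.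
    have rab : a <= r <= b by rewrite (le_trans ap pr) (le_trans rq qb).
    have B1 := Hr1 t tab nN n1 r rab (le_lt_trans rt st1).
    have B2 := Hr2 t tab nN n2 r rab (le_lt_trans rt st2).
    rewrite -/(x1 r) -/(x1 t) in B1.
    have -> : x2 r - x2 t - k t * (x1 r - x1 t) =
        (x2 r - x2 t - u2 t * (r - t)) - k t * (x1 r - x1 t - u1 t * (r - t)).
      by rewrite /k; field.
    apply: le_trans (ler_normB _ _) _; rewrite normrM.
    apply: le_trans (lerD B2 (ler_pM _ _ kt B1)) _ => //.
    rewrite -[X in X + _]mul1r -mulrDl mulrA mulrCA mulfV ?gt_eqF// mulr1.
    by rewrite ler_pM2l.
  have tpq : p <= t <= q by rewrite pt.
  have spq : p <= s <= q by rewrite ps.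
  have [E1 E0] := jet_estimate ac1 acf0 acf1 N0 x1V der ap qb tpq A0 H2 spq.
  have Vqp0 : 0 <= V q - V p by rewrite subr_ge0 ndV.
  have le_e n : (n <= 2)%N -> e1 * M ^+ n <= eps.
    move=> n2'; rewrite /e1 mulrAC ler_pdivrMr// ler_pM2l//.
    have M2 : 0 < M ^+ 2 by rewrite exprn_gt0.
    case: n n2' => [|[|[|//]]] _.
    - by rewrite expr0 -addrA lerDl addr_ge0 ?ltW.
    - by rewrite expr1 addrAC lerDr addr_ge0 ?ler01 ?ltW.
    - by rewrite lerDr addr_ge0 ?ler01 ?ltW.
  split.
  - apply: le_trans E0 _; apply: (@le_trans _ _ (A * (M * `|s - t|) * (M * `|s - t|))).
      by apply: ler_pM => //; [exact: mulr_ge0|exact: ler_wpM2l].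
    have -> : A * (M * `|s - t|) * (M * `|s - t|) = (e1 * M ^+ 2) * `|s - t| ^+ 3.
      by rewrite /A; ring.
    by rewrite ler_wpM2r// ?exprn_ge0// le_e.
  - apply: le_trans E1 _; apply: (@le_trans _ _ (A * (M * `|s - t|))).
      exact: ler_wpM2l.
    have -> : A * (M * `|s - t|) = (e1 * M ^+ 1) * `|s - t| ^+ 2.
      by rewrite /A; ring.
    by rewrite ler_wpM2r// ?exprn_ge0// le_e.
  - apply: le_trans (H2 s spq) _; rewrite /A ler_wpM2r//.
    by have := le_e 0%N isT; rewrite expr0 mulr1.
pose X2 t := h2 (X1 t).
have dX2 (t : R) : is_derive t 1 X2 (h3 (X1 t) * v1 t).
  exact: (is_derive1_comp (dh2 _) (dX1 t)).
have dY1 (t : R) : is_derive t 1 (fun t => h1 (X1 t)) (h2 (X1 t) * v1 t).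
  exact: (is_derive1_comp (dh1 _) (dX1 t)).
have dY0 (t : R) : is_derive t 1 (fun t => h0 (X1 t)) (h1 (X1 t) * v1 t).
  exact: (is_derive1_comp (dh0 _) (dX1 t)).
apply: (@engel_lift_matching a b gamma K X1 X2 (fun t => X1 t * X2 t - h1 (X1 t))
  (fun t => h0 (X1 t) - X1 t * h1 (X1 t) + 2^-1 * (X1 t * X1 t * X2 t))
  v1 (fun t => h3 (X1 t) * v1 t)) => //.
- move=> t; apply: cvgM; last exact: cv1.
  apply: (@continuous_comp _ _ _ X1 h3); last exact: ch3.
  exact: is_derive_continuous (dX1 t).
- move=> t; apply: (is_derive_congr (is_derive_sub (is_derive_mul (dX1 t) (dX2 t)) (dY1 t))).
  by rewrite /X2; ring.
- move=> t; apply: (is_derive_congr (is_derive_add (is_derive_sub (dY0 t)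
    (is_derive_mul (dX1 t) (dY1 t))) (is_derive_scale 2^-1
    (is_derive_mul (is_derive_mul (dX1 t) (dX1 t)) (dX2 t))))).
  by rewrite /X2; field.
move=> t Kt; have [e1 e2 e3] := hK t Kt.
rewrite /X2 X1K// e1 e2 e3 /f0 /f1 -/(x1 t) -/(x2 t) -/(x3 t) -/(x4 t).
by split => //; field.
Qed.
End engel_lusin.

Unset Implicit Arguments.

Theorem theorem1p2 (R : realType) (a b : R) (hab : a < b)
    (gamma : R -> 'rV[R]_4) (hgamma : engel_horizontal a b gamma) :
  exists Gamma : R -> 'rV[R]_4,
    engel_C1_horizontal a b Gamma /\
    (0 < (@lebesgue_measure R) [set t : R | t \in `[a, b] /\ Gamma t = gamma t])%E.
Proof.
have [acg _] := hgamma.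
have [N [u1 [u2 [N0 H]]]] := horizontal_coordinates hgamma.
have [Z|[C [c [cC Cab C0 c0 Cinj]]]] := derivative_dichotomy (ltW hab)
  (ac_small (ac_coord ord0 acg)) (fun t tab nNt => let: And4 h _ _ _ := H t tab nNt in h).
- exact: (engel_lusin_constant hab acg N0 H Z).
- exact: (engel_lusin_transverse hab acg N0 H cC Cab C0 c0 Cinj).
Qed.
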